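(* For every $\varepsilon>0$ there exist constants $C>0$ and $n_0$ such that for every $n\ge n_0$ there is a subcubic graph $G$ on $n$ vertices (every vertex of degree at most $3$) with $c(G)\ge C\, n^{1/2-\varepsilon}$.
   Context: The game of Cops and Robbers on a graph $G$: first the cops (a fixed number of them) choose initial vertices, then the robber, knowing their positions, chooses an initial vertex. Thereafter the players alternate, cops first: on the cops' turn each cop either stays at its vertex or moves to an adjacent vertex, and on the robber's turn the robber does the same. The cops win if at some point a cop occupies the same vertex as the robber. The cop number $c(G)$ is the minimum number of cops that can guarantee capturing the robber on $G$. *)

(* Defs.v *)
From mathcomp Require Import all_boot all_order all_algebra.
From mathcomp Require Import boolp.

Set Implicit Arguments.
Unset Strict Implicit.
Unset Printing Implicit Defensive.

Record sgraph := SGraph {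
  vertex :> finType;
  adj : rel vertex;
  adj_sym : symmetric adj;
  adj_irrefl : irreflexive adj
}.

Definition degree (G : sgraph) (x : G) : nat := #|[set y | adj x y]|.

Definition subcubic (G : sgraph) : Prop := forall x : G, degree x <= 3.

Definition graph_connected (G : sgraph) : Prop :=
  forall x y : G, connect (@adj G) x y.

Definition legal_move (G : sgraph) (x y : G) : bool := (x == y) || adj x y.

(* A strategy maps the list of robber positions seen so far to the current
   positions of the k cops. Its value at [::] is the initial placement, chosen
   before the robber appears. *)
Definition cop_strategy (G : sgraph) (k : nat) := seq G -> {ffun 'I_k -> G}.

(* r i is the robber's position after i robber moves, r 0 being the initial
   choice. Letting r range over all legal walks covers all adaptive robbers, as
   the cops' replies are determined by their strategy. *)
Definition robber_walk (G : sgraph) (r : nat -> G) : Prop :=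
  forall i, legal_move (r i) (r i.+1).

(* Positions after i moves of the cops, which have then seen r 0 .. r i.-1. *)
Definition cops_at (G : sgraph) (k : nat) (s : cop_strategy G k)
    (r : nat -> G) (i : nat) : {ffun 'I_k -> G} := s (mkseq r i).

Definition cops_legal (G : sgraph) (k : nat) (s : cop_strategy G k)
    (r : nat -> G) : Prop :=
  forall i (j : 'I_k), legal_move (cops_at s r i j) (cops_at s r i.+1 j).

(* The order of events is cops_at 0, r 0, cops_at 1, r 1, and so on: a capture
   occurs either just after a robber's turn or just after a cops' turn. *)
Definition captured (G : sgraph) (k : nat) (s : cop_strategy G k)
    (r : nat -> G) : Prop :=
  exists i (j : 'I_k), cops_at s r i j = r i \/ cops_at s r i.+1 j = r i.

Definition cops_win (G : sgraph) (k : nat) : Prop :=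
  exists s : cop_strategy G k,
    forall r, robber_walk r -> cops_legal s r /\ captured s r.

Lemma cops_win_card (G : sgraph) : cops_win G #|G|.
Proof.
exists (fun=> [ffun j => enum_val j]) => r _; split.
  by move=> i j; rewrite /legal_move eqxx.
by exists 0, (enum_rank (r 0)); left; rewrite ffunE enum_rankK.
Qed.

Lemma ex_cops_win (G : sgraph) : exists k, `[< cops_win G k >].
Proof. by exists #|G|; apply/asboolP/cops_win_card. Qed.

Definition cop_number (G : sgraph) : nat := ex_minn (ex_cops_win G).

(* Main.v *)
Require Import Defs.
From mathcomp Require Import all_boot all_order all_algebra all_fingroup.
From mathcomp Require Import boolp zify lra reals exp.

(** Let H be a rooted tree together with a perfect matching of its leaves. The
    tree consists of N binary trees with D = 2^(h+1) leaves each, every leaf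
    hanging on a long stem, whose roots are tied together by paths too long to
    matter. A first-moment argument gives a matching such that the number of
    nonbacktracking walks with at most K crossings of the matching between two
    given trees is bounded by a constant, although N is only D^(K+1).

    The robber never turns back: she climbs to the root of a binary tree,
    descends into its other half and crosses the matching. The danger of her
    position is a weighted count of the nonbacktracking walks ahead of her that
    end at a cop, the weight of a walk decaying geometrically with its length.
    A move of a cop lengthens or shortens each walk by one, so a full period of
    the robber costs a factor 2^(h-1) plus the few walks that were too long to
    be counted before, while choosing the less dangerous child at each of h
    branchings gains a factor 2^h. Hence about D^(K/2) cops never catch her, on
    a graph with D^(K+O(1)) vertices; finally K tends to infinity. *)

Set Implicit Arguments.
Unset Strict Implicit.
Unset Printing Implicit Defensive.

(** * Nonbacktracking walks and the escape criterion *)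

(** [Inv] describes the position after the robber's turn. Playing the cops' strategy against the
    evader produces one concrete walk, and [Hs] applied to that walk contradicts [Inv]. *)
Lemma robber_evades (G : sgraph) (k : nat) (St : Type) (pos : St -> G)
    (Inv : {ffun 'I_k -> G} -> St -> Prop) :
  (forall X, exists st, Inv X st) ->
  (forall X st, Inv X st -> forall j, X j <> pos st) ->
  (forall (X X' : {ffun 'I_k -> G}) st, Inv X st -> (forall j, legal_move (X j) (X' j)) ->
     (forall j, X' j <> pos st) /\
     exists2 st', legal_move (pos st) (pos st') & Inv X' st') ->
  ~ cops_win G k.
Proof.
move=> Hinit Hsafe Hstep [s Hs].
have [st0 Hst0] := Hinit (s [::]).
have [nxt Hnxt] : {nxt : {ffun 'I_k -> G} -> St -> St | forall X' st,
    legal_move (pos st) (pos (nxt X' st)) /\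
    ((exists2 st', legal_move (pos st) (pos st') & Inv X' st') ->
      Inv X' (nxt X' st))}.
  suff /choice [f Hf] : forall z : {ffun 'I_k -> G} * St, exists st1,
      legal_move (pos z.2) (pos st1) /\
      ((exists2 st', legal_move (pos z.2) (pos st') & Inv z.1 st') ->
        Inv z.1 st1).
    by exists (fun X st => f (X, st)) => X st; exact: (Hf (X, st)).
  move=> [X st] /=.
  have [[st' H1 H2]|H] := pselect (exists2 st', legal_move (pos st) (pos st') & Inv X st').
    by exists st'.
  (* Staying put is the default, because the walk must be legal before [Hs] can tell that the cops
     move legally. *)
  by exists st; rewrite /legal_move eqxx.
pose hst := fix hst n : seq G * St := match n with
  | 0 => ([::], st0)
  | n.+1 => let: (l, st) := hst n in
            let l' := rcons l (pos st) in (l', nxt (s l') st) end.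
pose r n := pos (hst n).2.
have hstE n : (hst n).1 = mkseq r n.
  elim: n => [//|n IH]; rewrite /mkseq -addn1 iotaD map_cat /= -/(mkseq r n) -IH.
  by rewrite /r addn1 /=; case: (hst n) => l st /=; rewrite cats1.
have hstS n : (hst n.+1).2 = nxt (cops_at s r n.+1) (hst n).2.
  by rewrite /cops_at -hstE /=; case: (hst n).
have rw : robber_walk r.
  by move=> n; rewrite /r hstS; case: (Hnxt (cops_at s r n.+1) (hst n).2).
have [leg [i [j cap]]] := Hs r rw.
have HI n : Inv (cops_at s r n) (hst n).2.
  elim: n => [//|n IH]; rewrite hstS.
  have [_ ex] := Hstep _ _ _ IH (leg n).
  by case: (Hnxt (cops_at s r n.+1) (hst n).2) => _; exact.
case: cap => cap; first exact: (Hsafe _ _ (HI i) j).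
have [H _] := Hstep _ _ _ (HI i) (leg i).
exact: (H j).
Qed.

Section NonBacktracking.
Variable G : sgraph.
Implicit Types p c x y n : G.

(** Continuations, by [r] further steps, of a step from [p] to [c]; [nba] also prescribes the last
    step, which for [r = 0] is the step from [p] to [c] itself. *)
Fixpoint nbw (r : nat) p c x : nat :=
  if r is r'.+1 then \sum_(n | adj c n && (n != p)) nbw r' c n x else (c == x).

Fixpoint nba (r : nat) p c y x : nat :=
  if r is r'.+1 then \sum_(n | adj c n && (n != p)) nba r' c n y x
  else (p == y) && (c == x).

Lemma nbw_sum_nba r p c x : nbw r p c x = \sum_y nba r p c y x.
Proof.
elim: r p c => [|r IH] p c /=.
  rewrite (bigD1 p) //= eqxx big1 ?addn0 // => y ynp.
  by rewrite eq_sym (negPf ynp).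
by rewrite exchange_big /=; apply: eq_bigr => n _; exact: IH.
Qed.

Lemma nbaSr r p c y x :
  nba r.+1 p c y x = adj y x * \sum_(y' | y' != x) nba r p c y' y.
Proof.
elim: r p c => [|r IH] p c; last first.
  rewrite [LHS]/= (eq_bigr (fun n => adj y x * \sum_(y' | y' != x) nba r c n y' y));
    last by move=> n _; rewrite -IH.
  by rewrite -big_distrr /= exchange_big.
rewrite /= big_mkcond /= (bigD1 x) //= [X in _ + X]big1 ?addn0; last first.
  by move=> i /negPf nx; rewrite nx andbF if_same.
rewrite eqxx andbT.
have [->|ncy] := eqVneq c y; last first.
  by rewrite if_same big1 ?muln0 // => i _; rewrite andbF.
rewrite big_mkcond /= (bigD1 p) //= eqxx /= big1 ?addn0; last first.
  by move=> i /negPf; rewrite eq_sym => ->; rewrite if_same.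
by rewrite eq_sym; case: (adj y x); case: (p != x).
Qed.

(** A walk to [x'] that does not arrive from [x] extends by the step to [x]. One that does arrive
    from [x] loses its last step and becomes a walk to [x] that did not come from [x']; as [x]
    differs from [p], it has a step to lose. *)
Lemma nbw_move r p c x x' : adj x x' -> x <> p ->
  nbw r p c x' + (if r is r'.+1 then nba r' p c x' x else 0)
   <= nba r.+1 p c x' x + (if r is r'.+1 then nbw r' p c x else 0).
Proof.
move=> axx' xp; rewrite nbaSr adj_sym axx' mul1n.
rewrite nbw_sum_nba (bigD1 x) //=.
case: r => [|r].
  have /negPf px : p != x by apply/eqP => E; apply: xp.
  by rewrite /= px add0n !addn0.
rewrite nbaSr axx' mul1n nbw_sum_nba.
rewrite [X in _ <= _ + X](bigD1 x') //=; lia.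
Qed.

(* Appending or deleting the step of the cop maps walks to x' injectively into
   walks to x, and changes the length by one. *)
Lemma cop_step (w : nat -> nat) (m : nat) p c x x' :
  (forall a b, a <= b -> w b <= w a) -> legal_move x x' -> x <> p ->
  \sum_(r < m) w r.+1 * nbw r p c x' <= \sum_(r < m.+1) w r * nbw r p c x.
Proof.
move=> anti /orP [/eqP <-|axx'] xp.
  rewrite big_ord_recr /=; apply: leq_trans (leq_addr _ _).
  by apply: leq_sum => i _; rewrite leq_mul2r anti ?orbT.
have nba_le r : nba r p c x' x <= nbw r p c x.
  by rewrite nbw_sum_nba (bigD1 x') //= leq_addr.
(* Walks to [x] that arrive from [x'] pay for the extended walks, the others for the shortened
   ones. *)
have split_n r : nbw r p c x = nba r p c x' x + (nbw r p c x - nba r p c x' x).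
  by rewrite subnKC.
rewrite [X in _ <= X](eq_bigr (fun r : 'I_m.+1 => w r * nba r p c x' x +
  w r * (nbw r p c x - nba r p c x' x))); last first.
  by move=> r _; rewrite -mulnDr -split_n.
rewrite big_split /=.
have step r : w r.+1 * nbw r p c x' <= w r.+1 * nba r.+1 p c x' x +
    (if r is r'.+1 then w r' * (nbw r' p c x - nba r' p c x' x) else 0).
  have := nbw_move r c axx' xp; case: r => [|r] H.
    by rewrite addn0 leq_mul2l; move: H; rewrite !addn0 => ->; rewrite orbT.
  apply: (@leq_trans (w r.+2 * (nba r.+2 p c x' x + (nbw r p c x - nba r p c x' x)))).
    by rewrite leq_mul2l; apply/orP; right; have := nba_le r; lia.
  by rewrite mulnDr leq_add2l leq_mul2r anti ?orbT // ltnW.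
apply: (@leq_trans (\sum_(r < m) (w r.+1 * nba r.+1 p c x' x +
    (if val r is r'.+1 then w r' * (nbw r' p c x - nba r' p c x' x) else 0)))).
  by apply: leq_sum => r _; exact: step.
rewrite big_split /= leq_add //.
  by rewrite big_ord_recl leq_addl.
case: m => [|m]; first by rewrite big_ord0.
by rewrite big_ord_recl add0n 2!big_ord_recr /= -addnA leq_addr.
Qed.

End NonBacktracking.

(* The weight of a walk of length r seen from phase i depends only on r + 2 i,
   because one round can shorten a walk by two. *)
Section Escape.
Variables (G : sgraph) (T h Q : nat).
Variable I : nat -> G -> G -> Prop.
Hypothesis h_gt0 : 0 < h.
Hypothesis h_leT : h < T.
Hypothesis I_one : forall i p c, i < T -> I i p c ->
  exists2 n, adj c n && (n != p) & I (if i.+1 == T then 0 else i.+1) c n.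
Hypothesis I_two : forall i p c, i < h -> I i p c ->
  exists n1 n2, [/\ n1 != n2, adj c n1 && (n1 != p), adj c n2 && (n2 != p),
    I i.+1 c n1 & I i.+1 c n2].

(** Constant on blocks of length [2 T], with ratio [2 ^ h.-1] between consecutive blocks; [wlen]
    spans [Q + 2] blocks, the last of weight 1. *)
Definition wt (t : nat) : nat := 2 ^ (h.-1 * (Q.+1 - t %/ T.*2)).
Definition wlen : nat := T.*2 * Q.+2.
Definition danger (i : nat) (p c x : G) : nat :=
  \sum_(r < wlen - i.*2) wt (r + i.*2) * nbw r p c x.

Lemma wt_anti a b : a <= b -> wt b <= wt a.
Proof.
move=> ab; rewrite /wt leq_pexp2l // leq_mul2l leq_sub2l ?orbT //.
by rewrite leq_div2r.
Qed.

Lemma wt_small t : t < T.*2 -> wt t = 2 ^ (h.-1 * Q.+1).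
Proof. by move=> tT; rewrite /wt divn_small // subn0. Qed.

Lemma wt_shift t : wt t <= 2 ^ h.-1 * wt (t + T.*2).
Proof.
rewrite /wt -expnD leq_pexp2l // divnDr ?dvdnn // divnn.
have -> : (0 < T.*2) = true by rewrite double_gt0; lia.
by rewrite -mulnS leq_mul2l; apply/orP; right; lia.
Qed.

Lemma wt_far t : T.*2 * Q.+1 <= t -> wt t = 1.
Proof.
move=> H; rewrite /wt; have -> : Q.+1 - t %/ T.*2 = 0; last by rewrite muln0.
by apply/eqP; rewrite subn_eq0 leq_divRL 1?mulnC // double_gt0; lia.
Qed.

Definition branch (i : nat) (c n x : G) : nat :=
  \sum_(r < (wlen - i.*2).-1) wt (r.+1 + i.*2) * nbw r c n x.

Lemma sum_branch i p c x : i < T ->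
  \sum_(n | adj c n && (n != p)) branch i c n x <= danger i p c x.
Proof.
move=> iT; rewrite /danger /branch.
have : 0 < wlen - i.*2 by rewrite /wlen; nia.
case: (wlen - i.*2) => [//|m] _; rewrite big_ord_recl /=.
rewrite exchange_big /=; apply: leq_trans (leq_addl _ _).
apply: leq_sum => r _; rewrite -big_distrr /=.
by rewrite leq_mul2l; apply/orP; right; exact: leqnn.
Qed.

(** This is [cop_step] with the weights shifted by [2 i + 1]: raising the phase shifts by 2, of
    which one unit is spent by the robber's step and one by the cop's. *)
Lemma danger_step i c n x x' : i.+1 < T -> legal_move x x' -> x <> c ->
  danger i.+1 c n x' <= branch i c n x.
Proof.
move=> iT mv xc; rewrite /danger /branch.
have -> : (wlen - i.*2).-1 = (wlen - i.+1.*2).+1 by rewrite /wlen; nia.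
rewrite (eq_bigr (fun r : 'I__ => wt (r.+1 + i.*2.+1) * nbw r c n x')); last first.
  by move=> r _; congr (wt _ * _); lia.
apply: leq_trans (@cop_step G (fun r => wt (r + i.*2.+1)) _ c n x x' _ mv xc) _.
  by move=> a b ab; apply: wt_anti; lia.
by apply: leq_sum => r _; rewrite addnS addSn.
Qed.

(** Resetting the phase moves every length by one block, whence the factor [2 ^ h.-1]. Walks in the
    last block were beyond the cut-off before; they have weight 1 and go into the second sum. *)
Lemma danger_wrap c n x x' : legal_move x x' -> x <> c ->
  danger 0 c n x' <= 2 ^ h.-1 * branch T.-1 c n x + \sum_(r < wlen) nbw r c n x'.
Proof.
move=> mv xc.
have T0 : 0 < T by lia.
rewrite /danger; have -> : wlen - 0.*2 = wlen by lia.
have Hm : wlen = (wlen - T.*2) + T.*2 by rewrite /wlen; nia.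
apply: (@leq_trans (\sum_(r < wlen - T.*2) 2 ^ h.-1 * (wt (r + T.*2) * nbw r c n x')
    + \sum_(r < wlen) nbw r c n x')); last first.
  rewrite leq_add2r -big_distrr /= leq_mul2l; apply/orP; right.
  rewrite /branch.
  have -> : (wlen - T.-1.*2).-1 = (wlen - T.*2).+1 by rewrite /wlen; nia.
  rewrite (eq_bigr (fun r : 'I__ => wt (r.+1 + T.-1.*2.+1) * nbw r c n x')); last first.
    by move=> r _; congr (wt _ * _); lia.
  apply: leq_trans (@cop_step G (fun r => wt (r + T.-1.*2.+1)) _ c n x x' _ mv xc) _.
    by move=> a b ab; apply: wt_anti; lia.
  by apply: leq_sum => r _; rewrite addnS addSn.
have far (r : 'I_T.*2) : wt (wlen - T.*2 + r + 0.*2) = 1.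
  by apply: wt_far; rewrite /wlen; nia.
rewrite Hm !big_split_ord /= -Hm leq_add //.
  apply: leq_sum => r _; rewrite mulnA leq_mul2r; apply/orP; right.
  by rewrite addn0; exact: wt_shift.
rewrite (eq_bigr (fun r : 'I_T.*2 => nbw (wlen - T.*2 + r) c n x')) ?leq_addl //.
by move=> r _; rewrite far mul1n.
Qed.

Variables (k cc : nat).
Hypothesis cc_bound : forall p c x, I 0 p c -> \sum_(r < wlen) nbw r p c x <= cc.
Hypothesis k_small : (k * cc).*2 < 2 ^ (h.-1 * Q.+1).
Hypothesis I_init : forall X : {ffun 'I_k -> G}, exists p c,
  [/\ I 0 p c, forall j, X j <> p & \sum_j danger 0 p c (X j) < 2 ^ (h.-1 * Q.+1)].

(** The threshold is the weight of a walk in the first block, and [2 ^ minn i h] records the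
    halvings made so far. A cop on [p] is excluded separately, since it could catch the robber from
    behind. *)
Let Inv (X : {ffun 'I_k -> G}) (st : nat * G * G) : Prop :=
  let: (i, p, c) := st in
  [/\ i < T, I i p c, forall j, X j <> p &
    2 ^ minn i h * \sum_j danger i p c (X j) < 2 ^ (h.-1 * Q.+1)].

Lemma danger_near i p c x r : i < T -> r < 2 -> 0 < nbw r p c x ->
  2 ^ (h.-1 * Q.+1) <= danger i p c x.
Proof.
move=> iT r2 w0.
have rl : r < wlen - i.*2 by rewrite /wlen; nia.
rewrite /danger (bigD1 (Ordinal rl)) //=; apply: leq_trans (leq_addr _ _).
by rewrite wt_small ?leq_pmulr //; lia.
Qed.

Theorem escape : ~ cops_win G k.
Proof.
have sumD i p c (X : {ffun 'I_k -> G}) j : danger i p c (X j) <=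
    2 ^ minn i h * \sum_j danger i p c (X j).
  rewrite (bigD1 j) //= mulnDr; apply: leq_trans (leq_addr _ _).
  by rewrite leq_pmull // expn_gt0.
have safe X st : Inv X st -> forall j, X j <> st.2.
  move: st => [[i p] c] [iT _ _ small] j /= E.
  have := @danger_near i p c (X j) 0 iT isT.
  by rewrite /= E eqxx => /(_ isT); have := sumD i p c X j; rewrite E; lia.
apply: (@robber_evades G k (nat * G * G) snd Inv) => //.
  move=> X; have [p [c [H1 H2 H3]]] := I_init X.
  by exists (0, p, c); split=> //; [lia | rewrite min0n mul1n].
move=> X X' [[i p] c] HI mv; have sf := safe _ _ HI.
move: HI => [iT Ii Xp small] /=.
(* A cop stepping onto [c] comes from a neighbour other than [p], hence from the end of a
   nonbacktracking walk of length 1, whose weight alone reaches the threshold. *)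
have sf' j : X' j <> c.
  move=> E; case/orP: (mv j) => [/eqP E'|a]; first by apply: (sf j); rewrite E' E.
  have := @danger_near i p c (X j) 1 iT isT.
  rewrite /= (bigD1 (X j)) /=; last first.
    by rewrite adj_sym -E a; apply/eqP; exact: Xp.
  by rewrite eqxx => /(_ isT); have := sumD i p c X j; lia.
split=> //.
have tot : \sum_(n | adj c n && (n != p)) \sum_j branch i c n (X j) <=
    \sum_j danger i p c (X j).
  by rewrite exchange_big /=; apply: leq_sum => j _; exact: sum_branch.
have lm n : adj c n -> legal_move c n by move=> a; rewrite /legal_move a orbT.
have [ih|ih] := ltnP i h.
  have [n1 [n2 [n12 a1 a2 I1 I2]]] := I_two ih Ii.
  have : \sum_j branch i c n1 (X j) + \sum_j branch i c n2 (X j) <=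
      \sum_j danger i p c (X j).
    apply: leq_trans tot; rewrite (bigD1 n1) //= leq_add2l (bigD1 n2) /= ?leq_addr //.
    by rewrite a2 eq_sym n12.
  have mk n : adj c n && (n != p) -> I i.+1 c n ->
      2 * (\sum_j branch i c n (X j)) <= \sum_j danger i p c (X j) ->
      exists2 st', legal_move c st'.2 & Inv X' st'.
    move=> /andP[a np] In le2; exists (i.+1, c, n); first exact: lm.
    split=> //; first lia.
    apply: leq_ltn_trans small.
    have -> : minn i.+1 h = i.+1 by lia.
    have -> : minn i h = i by lia.
    rewrite expnSr -mulnA leq_mul2l; apply/orP; right.
    apply: leq_trans le2; rewrite leq_mul2l /=.
    by apply: leq_sum => j _; apply: danger_step => //; lia.
  move=> le12.
  case: (leqP (\sum_j branch i c n1 (X j)) (\sum_j branch i c n2 (X j))) => cmp.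
    by apply: (mk n1) => //; lia.
  by apply: (mk n2) => //; lia.
have [n an In] := I_one iT Ii.
have le1 : \sum_j branch i c n (X j) <= \sum_j danger i p c (X j).
  by apply: leq_trans tot; rewrite (bigD1 n) //= leq_addr.
exists (if i.+1 == T then 0 else i.+1, c, n); first by case/andP: an => /lm.
split=> //; first by case: eqP => ?; lia.
move: In; case: eqP => [iT'|iT'] In; last first.
  apply: leq_ltn_trans small.
  have -> : minn i.+1 h = h by lia.
  have -> : minn i h = h by lia.
  rewrite leq_mul2l; apply/orP; right; apply: leq_trans le1.
  by apply: leq_sum => j _; apply: danger_step => //; lia.
rewrite min0n mul1n.
have Ei : i = T.-1 by lia.
have le3 : \sum_j danger 0 c n (X' j) <=
   2 ^ h.-1 * \sum_j danger i p c (X j) + k * cc.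
  apply: (@leq_trans (\sum_(j < k) (2 ^ h.-1 * branch i c n (X j) + cc))).
    apply: leq_sum => j _; apply: leq_trans (danger_wrap n (mv j) (sf j)) _.
    by rewrite Ei leq_add2l; exact: cc_bound.
  rewrite big_split /= -big_distrr /= sum_nat_const card_ord leq_add2r.
  by rewrite leq_mul2l le1 orbT.
(* As [2 ^ h] times the old danger is below the threshold, its first contribution is below half of
   it; [k_small] leaves the other half for [k * cc]. *)
have e2 : 2 ^ h = 2 * 2 ^ h.-1 by rewrite -expnS prednK.
move: small; have -> : minn i h = h by lia.
rewrite e2; move: le3 k_small; lia.
Qed.

End Escape.

(** * Random matchings with few short walks *)

Section Matchings.
Variable P : finType.
Implicit Types (m : {perm P}) (S : seq P).

Definition matching m : bool := [forall x, (m (m x) == x) && (m x != x)].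

Lemma matchingK m : matching m -> forall x, m (m x) = x.
Proof. by move=> /forallP H x; case/andP: (H x) => /eqP. Qed.

Lemma matching_neq m : matching m -> forall x, m x != x.
Proof. by move=> /forallP H x; case/andP: (H x). Qed.

Definition extending S (m0 : {perm P}) : {set {perm P}} :=
  [set m | matching m & all (fun x => m x == m0 x) S].

Definition closed_under m S := forall x, x \in S -> m x \in S.

(* Conjugating by the transposition (mu z) moves the partner of lam from mu to
   an arbitrary unmatched z. *)
Lemma card_extending_match S m0 lam mu : closed_under m0 S -> lam \notin S ->
  #|[set m in extending S m0 | m lam == mu]| * (#|P| - (size S).+1)
    <= #|extending S m0|.
Proof.
move=> cl lS; set A := [set m in _ | _].
have [->|[m1 m1A]] := set_0Vmem A; first by rewrite cards0.
have AP m : m \in A -> [/\ matching m, {in S, m =1 m0} & m lam = mu].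
  rewrite !inE => /andP[/andP[mm /allP ms] /eqP ml]; split=> // x xS.
  by apply/eqP/ms.
have [mm1 ms1 ml1] := AP _ m1A.
have muS : mu \notin S.
  apply/negP => muS; have := cl _ muS; rewrite -ms1 // -ml1 matchingK //.
  by rewrite (negPf lS).
have mul : mu != lam by rewrite -ml1 matching_neq.
pose Z := [set z | z \notin lam :: S].
have cardZ : #|P| - (size S).+1 <= #|Z|.
  have : #|~: Z| <= (size S).+1.
    apply: leq_trans (card_size (lam :: S)); apply: subset_leq_card.
    by apply/subsetP => z; rewrite !inE negbK.
  have := cardsC Z; lia.
pose f (mz : {perm P} * P) := (tperm mu mz.2 * mz.1 * tperm mu mz.2)%g.
have fE m z x : f (m, z) x = tperm mu z (m (tperm mu z x)) by rewrite !permM.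
have fl m z : m \in A -> z \in Z -> f (m, z) lam = z.
  move=> /AP [_ _ ml]; rewrite !inE negb_or => /andP[zl _].
  by rewrite fE (tpermD mul zl) ml tpermL.
apply: leq_trans (leq_mul (leqnn _) cardZ) _; rewrite -cardsX.
rewrite -(@card_in_imset _ _ f) => [|[m z] [m' z']]; last first.
  rewrite !in_setX /= => /andP[mA zZ] /andP[mA' zZ'] E.
  have Ez : z = z' by rewrite -(fl m z) // E fl.
  rewrite -Ez in E *; congr pair.
  by move: E; rewrite /f /= => /mulIg /mulgI.
apply: subset_leq_card; apply/subsetP => _ /imsetP[[m z] mz ->].
move: mz; rewrite in_setX /= => /andP[/AP [mm ms ml] zZ].
rewrite inE; apply/andP; split.
  apply/forallP => x; rewrite !fE tpermK matchingK // tpermK eqxx /=.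
  apply/eqP => E; have := matching_neq mm (tperm mu z x).
  by rewrite -{2}E tpermK eqxx.
apply/allP => x xS; move: zZ; rewrite !inE negb_or => /andP[_ zS].
have nS y : y \in S -> tperm mu z y = y.
  by move=> yS; apply: tpermD; apply/eqP => E; [move: muS | move: zS]; rewrite E yS.
by rewrite fE nS // ms // nS // cl.
Qed.

(** Conditioning on one more revealed edge gives a space of the same form, so an exploration can be
    analysed edge by edge. *)
Lemma extending_cons S m0 m1 lam mu :
  m1 \in extending S m0 -> m1 lam = mu ->
  [set m in extending S m0 | m lam == mu] = extending (lam :: mu :: S) m1.
Proof.
rewrite inE => /andP[mm1 /allP ms1] ml1; apply/setP => m; rewrite !inE /=.
have [mm|] /= := boolP (matching m); last by [].
rewrite ml1.
have [E|] := eqVneq (m lam) mu; last by rewrite andbF.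
rewrite andbT /=.
have -> : m mu == m1 mu by rewrite -{1}E -ml1 !matchingK.
rewrite /=; apply: eq_in_all => x xS.
by rewrite (eqP (ms1 _ xS)).
Qed.

End Matchings.

Lemma card_fibres (A B : finType) (X : {set A}) (f : A -> B) :
  #|X| = \sum_b #|[set a in X | f a == b]|.
Proof.
rewrite -sum1_card (partition_big f predT) //=; apply: eq_bigr => b _.
by rewrite sum1dep_card; apply: eq_card => a; rewrite !inE.
Qed.

(** * Revealing a matching along walks, and the first-moment bound *)

Section Walks.
Variables (P U : finType) (vt : P -> U) (D : nat) (port : U -> 'I_D -> P).
Hypothesis portP : forall lam, exists a, port (vt lam) a = lam.

Lemma card_ports (tgt : seq U) : #|[set mu | vt mu \in tgt]| <= size tgt * D.
Proof.
have sz : size [seq port v a | v <- tgt, a <- enum 'I_D] = size tgt * D.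
  by rewrite size_allpairs size_enum_ord.
rewrite -sz; apply: leq_trans (card_size _); apply: subset_leq_card.
apply/subsetP => mu; rewrite inE => mt; have [a Ea] := portP mu.
by apply/allpairsP; exists (vt mu, a); split=> //=; rewrite mem_enum.
Qed.

Section Exploration.
Variables u w : U.

(* A token (a, b) makes the exploration leave the current vertex through port a;
   b marks the last step of a walk, which must end in a vertex that is already a
   target, whereupon a new walk starts at u. Every step uses a fresh edge. *)
Fixpoint explores (m : {perm P}) (S : seq P) (cur : U) (tgt : seq U)
    (ts : seq ('I_D * bool)) : bool :=
  if ts is (a, b) :: ts' then
    let lam := port cur a in
    (lam \notin S) &&
    (if b then (vt (m lam) \in tgt) &&
               explores m (lam :: m lam :: S) u [:: w; u] ts'
     else explores m (lam :: m lam :: S) (vt (m lam)) (vt (m lam) :: tgt) ts')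
  else true.

(** Partners are revealed one at a time. An unmarked token costs nothing; a marked one must hit one
    of at most [Tm * D] ports at targets, each with probability at most [1 / B]. The condition
    [2 + size ts <= Tm] covers the restart with two targets. *)
Lemma card_explores (B Tm : nat) ts S m0 cur tgt :
  closed_under m0 S ->
  (size S + (size ts).*2).+1 + B <= #|P| ->
  size tgt + size ts <= Tm -> 2 + size ts <= Tm ->
  #|[set m in extending S m0 | explores m S cur tgt ts]| * B ^ count snd ts
    <= #|extending S m0| * (Tm * D) ^ count snd ts.
Proof.
elim: ts S m0 cur tgt => [|[a b] ts IH] S m0 cur tgt cl sP st1 st2.
  rewrite !muln1; apply: subset_leq_card; apply/subsetP => m.
  by rewrite inE => /andP[].
set lam := port cur a.
have [lS|lS] := boolP (lam \in S).
  set A := [set m in _ | _].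
  suff -> : A = set0 by rewrite cards0.
  by apply/setP => m; rewrite !inE /= -/lam lS andbF.
pose rest m mu := if b then explores m (lam :: mu :: S) u [:: w; u] ts
  else explores m (lam :: mu :: S) (vt mu) (vt mu :: tgt) ts.
have key mu : #|[set m in [set m in extending S m0 | m lam == mu] | rest m mu]|
     * B ^ count snd ts
   <= #|[set m in extending S m0 | m lam == mu]| * (Tm * D) ^ count snd ts.
  have [->|[m1]] := set_0Vmem [set m in extending S m0 | m lam == mu].
    rewrite cards0 mul0n leqn0 muln_eq0; apply/orP; left; rewrite cards_eq0.
    by apply/eqP/setP => m; rewrite !inE.
  rewrite inE => /andP[m1X /eqP m1l].
  rewrite (extending_cons m1X m1l).
  have [mm1 ms1] : matching m1 /\ {in S, m1 =1 m0}.
    move: m1X; rewrite inE => /andP[mm1 /allP ms1]; split=> // x xS.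
    by apply/eqP/ms1.
  have cl1 : closed_under m1 (lam :: mu :: S).
    move=> x; rewrite !inE => /or3P[/eqP->|/eqP->|xS].
    - by rewrite m1l eqxx orbT.
    - by rewrite -m1l matchingK // eqxx.
    - by rewrite ms1 // cl // !orbT.
  rewrite /rest; case: (b); apply: IH => //=; move: sP st1 st2 => /=; lia.
have split_ev : #|[set m in extending S m0 | explores m S cur tgt ((a, b) :: ts)]| =
   \sum_mu #|[set m in [set m in extending S m0 | m lam == mu] |
     (b ==> (vt mu \in tgt)) && rest m mu]|.
  rewrite (card_fibres _ (fun m : {perm P} => m lam)); apply: eq_bigr => mu _.
  apply: eq_card => m; rewrite !inE /= -/lam lS /= /rest.
  have [->|] := eqVneq (m lam) mu; last by rewrite !andbF.
  by rewrite !andbT; case: (b).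
rewrite split_ev.
have cardX : #|extending S m0| = \sum_mu #|[set m in extending S m0 | m lam == mu]|.
  exact: card_fibres.
case Eb : b => /=; last first.
  rewrite !add0n cardX !big_distrl /=; apply: leq_sum => mu _.
  exact: key.
rewrite !add1n !expnS.
rewrite (bigID (fun mu => vt mu \in tgt)) /= [X in _ + X]big1 ?addn0; last first.
  move=> mu /negPf nt; apply/eqP; rewrite cards_eq0; apply/eqP/setP => m.
  by rewrite !inE nt /= andbF.
apply: (@leq_trans (\sum_(mu | vt mu \in tgt) #|extending S m0| * (Tm * D) ^ count snd ts)).
  rewrite big_distrl /=; apply: leq_sum => mu mt.
  rewrite mulnCA.
  apply: (@leq_trans (B * (#|[set m in extending S m0 | m lam == mu]|
      * (Tm * D) ^ count snd ts))).
    rewrite leq_mul2l; apply/orP; right.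
    apply: leq_trans (key mu); rewrite leq_mul2r; apply/orP; right.
    by apply: subset_leq_card; apply/subsetP => m; rewrite !inE mt.
  rewrite mulnA leq_mul2r; apply/orP; right.
  apply: leq_trans (card_extending_match mu cl lS); rewrite mulnC leq_mul2l.
  by apply/orP; right; move: sP => /=; lia.
rewrite sum_nat_const mulnC -mulnA leq_mul2l; apply/orP; right.
rewrite mulnC leq_mul2r; apply/orP; right.
have := card_ports tgt; rewrite cardsE => H; apply: leq_trans H _.
by rewrite leq_mul2r; apply/orP; right; move: st1 => /=; lia.
Qed.

(** A walk is recorded by the ports through which it leaves its vertices; [f] is the port of the
    last arrival, closed for leaving. *)
Fixpoint nbchain (m : {perm P}) (v : U) (f : option P) (p : seq P) (t : U) : bool :=
  if p is lam :: p' then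
    [&& vt lam == v, Some lam != f & nbchain m (vt (m lam)) (Some (m lam)) p' t]
  else v == t.

(* Stopping at the first vertex seen before (or at w) turns a nonbacktracking
   walk into one whose edges are all new. *)
Lemma explores_walk (m : {perm P}) (S0 p S : seq P) cur f tgt : matching m ->
  p != [::] -> nbchain m cur f p w -> w \in tgt -> cur \in tgt ->
  {in p, forall x, x \notin S0} ->
  {in S, forall x, x \in S0 \/ vt x \in tgt /\ (vt x <> cur \/ Some x = f)} ->
  closed_under m S ->
  exists ts S', [/\ size ts <= size p, count snd ts = 1, closed_under m S',
    size S' = size S + (size ts).*2 &
    forall ts', explores m S' u [:: w; u] ts' -> explores m S cur tgt (ts ++ ts')].
Proof.
move=> mm; elim: p S cur f tgt => [//|lam p IH] S cur f tgt _ /=.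
move=> /and3P[/eqP vl /eqP lf ch] wt ct pS0 HS cl.
have [a Ea] := portP lam; rewrite vl in Ea.
(* A revealed port at the current vertex lies in [S0], which the walk avoids, or is the port of
   arrival, which [f] rules out. *)
have lS : lam \notin S.
  apply/negP => lS; have lS0 := pS0 lam (mem_head _ _).
  by case: (HS _ lS) => [|[_ []//]]; rewrite (negPf lS0).
have cl' : closed_under m (lam :: m lam :: S).
  move=> x; rewrite !inE => /or3P[/eqP->|/eqP->|/cl->]; rewrite ?eqxx ?orbT //.
  by rewrite matchingK // eqxx.
have [mt|mt] := boolP (vt (m lam) \in tgt).
  exists [:: (a, true)], (lam :: m lam :: S); split=> //=; first by rewrite addn2.
  by move=> ts' H; rewrite Ea lS mt.
have pn : p != [::].
  by apply/eqP => p0; move: ch; rewrite p0 /= => /eqP E; rewrite E wt in mt.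
have [||||x xp|x|//|ts [S' [H1 H2 H3 H4 H5]]] := IH (lam :: m lam :: S) (vt (m lam)) (Some (m lam))
   (vt (m lam) :: tgt).
- exact: pn.
- exact: ch.
- by rewrite inE wt orbT.
- by rewrite inE eqxx.
- by apply: pS0; rewrite inE xp orbT.
- rewrite !inE => /or3P[/eqP->|/eqP->|xS].
  + right; split; first by rewrite vl ct orbT.
    by left => E; move: mt; rewrite -E vl ct.
  + by right; split; [rewrite eqxx | right].
  + case: (HS _ xS) => [->|[xt _]]; [by left|right; split; first by rewrite xt orbT].
    by left => E; move: mt; rewrite -E xt.
exists ((a, false) :: ts), S'; split=> //=.
  by rewrite H4 /=; lia.
by move=> ts' H; rewrite Ea lS /=; exact: H5.
Qed.

(** The choice is greedy: the ports revealed by the earlier walks form the set [F] that the next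
    walk avoids. *)
Lemma explores_family (m : {perm P}) (K : nat) : matching m ->
  forall j (S : seq P), closed_under m S ->
  (forall F : seq P, closed_under m F -> size F <= size S + (K * j).*2 ->
    exists p : seq P, [/\ p != [::], size p <= K, nbchain m u None p w &
      {in p, forall x, x \notin F}]) ->
  exists ts, [/\ size ts <= K * j, count snd ts = j & explores m S u [:: w; u] ts].
Proof.
move=> mm; elim=> [|j IH] S cl H; first by exists [::]; rewrite muln0.
have [|p [pn pK ch pS]] := H S cl; first by rewrite leq_addr.
have [||x xS|ts [S' [H1 H2 H3 H4 H5]]] :=
  @explores_walk m S p S u None [:: w; u] mm pn ch _ _ pS _ cl.
- by rewrite inE eqxx.
- by rewrite !inE eqxx orbT.
- by left.
have {}H1 := leq_trans H1 pK.
have [|ts' [G1 G2 G3]] := IH S' H3.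
  by move=> F clF sF; apply: H => //; rewrite mulnS; lia.
exists (ts ++ ts'); split; last exact: H5.
  by rewrite size_cat mulnS; lia.
by rewrite count_cat H2 G2.
Qed.

End Exploration.

(** A union bound over both end vertices and all token sequences with [l] marks. If every matching
    lacked a small hitting set for some pair, each would realise one of these events by
    [explores_family], but the last hypothesis makes their expected number less than one. *)
Theorem good_matching (K l : nat) :
  (exists m : {perm P}, matching m) ->
  0 < D ->
  (K * l).*2.+1 < #|P| ->
  #|U| ^ 2 * ((K * l).+1 * (D * 2) ^ (K * l)) * ((K * l).+2 * D) ^ l
    < (#|P| - (K * l).*2.+1) ^ l ->
  exists2 m : {perm P}, matching m & forall u w, exists F : seq P,
    size F <= (K * l).*2 /\
    forall p, p != [::] -> size p <= K -> nbchain m u None p w -> has (mem F) p.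
Proof.
move=> [mm0 Hmm0] D0 HP Hcount; apply: contrapT => nogood.
have bad (m : {perm P}) : matching m -> exists u w ts,
    [/\ size ts <= K * l, count snd ts = l & explores u w m [::] u [:: w; u] ts].
  move=> mm; apply: contrapT => nb; apply: nogood; exists m => // u w.
  apply: contrapT => nF; apply: nb; exists u, w.
  have [] := @explores_family u w m K mm l [::] _ _ => //.
    move=> F clF sF; apply: contrapT => np; apply: nF; exists F; split=> //.
    move=> p pn pK ch; apply: contrapT => nh; apply: np; exists p; split=> //.
    by move=> x xp; apply/negP => xF; apply: nh; apply/hasP; exists x.
  by move=> ts Hts; exists ts.
have room q : q <= K * l -> (0 + q.*2).+1 + (#|P| - (K * l).*2.+1) <= #|P|.
  by move: HP; move: (K * l) #|P| => a b; lia.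
(* A token sequence of length at most [K * l] is encoded by its length and a padded tuple, which
   makes the index type finite. *)
pose ix := (U * U * ('I_(K * l).+1 * (K * l).-tuple ('I_D * bool)))%type.
pose toks (z : ix) := take z.2.1 z.2.2.
pose E (z : ix) := [set m : {perm P} | [&& matching m, count snd (toks z) == l &
   explores z.1.1 z.1.2 m [::] z.1.1 [:: z.1.2; z.1.1] (toks z)]].
pose Om := [set m : {perm P} | matching m].
have sub : Om \subset \bigcup_z E z.
  apply/subsetP => m; rewrite inE => mm; have [u [w [ts [H1 H2 H3]]]] := bad _ mm.
  pose t0 := (Ordinal D0, false).
  pose tt : seq _ := ts ++ nseq (K * l - size ts) t0.
  have stt : size tt == K * l by rewrite size_cat size_nseq subnKC.
  apply/bigcupP; exists ((u, w, (inord (size ts), Tuple stt)) : ix) => //.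
  have Et : toks (u, w, (inord (size ts), Tuple stt)) = ts.
    by rewrite /toks /= inordK // take_size_cat.
  by rewrite inE Et H2 eqxx mm.
have cardE z : #|E z| * (#|P| - (K * l).*2.+1) ^ l <= #|Om| * ((K * l).+2 * D) ^ l.
  have [ct|ct] := eqVneq (count snd (toks z)) l; last first.
    suff -> : E z = set0 by rewrite cards0.
    by apply/setP => m; rewrite !inE (negPf ct) andbF.
  have szt : size (toks z) <= K * l.
    by rewrite size_take size_tuple; have := ltn_ord z.2.1; case: ifP; lia.
  have := @card_explores z.1.1 z.1.2 (#|P| - (K * l).*2.+1) (K * l).+2 (toks z) [::] mm0
    z.1.1 [:: z.1.2; z.1.1]; rewrite ct /= => H.
  have E1 : extending [::] mm0 = Om by apply/setP => m; rewrite !inE /= andbT.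
  rewrite E1 in H.
  apply: leq_trans (H _ (room _ szt) _ _) => //.
  rewrite leq_mul2r; apply/orP; right; apply: subset_leq_card.
  by apply/subsetP => m; rewrite !inE => /and3P[-> _ ->].
have Om0 : 0 < #|Om| by apply/card_gt0P; exists mm0; rewrite inE.
have c1 : #|Om| * (#|P| - (K * l).*2.+1) ^ l <= #|{: ix}| * (#|Om| * ((K * l).+2 * D) ^ l).
  apply: (@leq_trans (\sum_z #|E z| * (#|P| - (K * l).*2.+1) ^ l)).
    rewrite -big_distrl /= leq_mul2r; apply/orP; right.
    apply: leq_trans (subset_leq_card sub) _.
    elim/big_rec2: _ => [|i a X _ IHi]; first by rewrite cards0.
    by apply: leq_trans (leq_card_setU _ _) _; rewrite leq_add2l.
  apply: (@leq_trans (\sum_(z : ix) #|Om| * ((K * l).+2 * D) ^ l)).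
    by apply: leq_sum => y _; exact: cardE.
  by rewrite sum_nat_const.
have ci : #|{: ix}| = #|U| ^ 2 * ((K * l).+1 * (D * 2) ^ (K * l)).
  by rewrite /ix !card_prod card_tuple !card_prod !card_ord card_bool expnS expn1.
rewrite ci mulnCA leq_pmul2l // in c1.
by move: c1; rewrite leqNgt Hcount.
Qed.

(** * From small hitting sets to bounds on the number of walks *)

Section Counting.
Variable m : {perm P}.

Fixpoint nbg (F : seq P) (k : nat) (v : U) (f : option P) (t : U) : nat :=
  if k is k'.+1 then
    \sum_(lam | [&& vt lam == v, Some lam != f & lam \notin F])
       nbg F k' (vt (m lam)) (Some (m lam)) t
  else (v == t).

Lemma nbg_None F k v f t : nbg F k v f t <= nbg F k v None t.
Proof.
case: k => [//|k] /=; rewrite big_mkcond [X in _ <= X]big_mkcond /=.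
apply: leq_sum => lam _; case: (vt lam == v) => //=.
by case: (lam \notin F); case: (Some lam != f).
Qed.

Lemma nbg_gt0 F k v f t : 0 < nbg F k v f t ->
  exists p, [/\ size p = k, nbchain m v f p t & ~~ has (mem F) p].
Proof.
elim: k v f => [|k IH] v f /=; first by rewrite lt0b => vt0; exists [::].
rewrite lt0n sum_nat_eq0 => /forallPn [lam]; rewrite negb_imply -lt0n.
move=> /andP[/and3P[H1 H2 H3] /IH [p [p1 p2 p3]]].
by exists (lam :: p); split; rewrite /= ?p1 ?H1 ?H2 ?negb_or ?H3.
Qed.

(* Split each walk at its first visit to F. *)
Lemma nbg_split F k v f t : nbg [::] k v f t <= nbg F k v f t +
  \sum_(i < k) \sum_(lam in F)
    nbg [::] i v f (vt lam) * nbg [::] (k - i.+1) (vt (m lam)) None t.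
Proof.
elim: k v f => [|k IH] v f; first by rewrite leq_addr.
rewrite [nbg [::] _ _ _ _]/= (bigID (fun lam => lam \in F)) /= addnC.
apply: (@leq_trans (
  \sum_(lam | [&& vt lam == v, Some lam != f & lam \notin F])
    (nbg F k (vt (m lam)) (Some (m lam)) t +
    \sum_(i < k) \sum_(lam' in F) nbg [::] i (vt (m lam)) (Some (m lam)) (vt lam')
       * nbg [::] (k - i.+1) (vt (m lam')) None t) +
  \sum_(lam in F) nbg [::] 0 v f (vt lam) * nbg [::] k (vt (m lam)) None t)).
  apply: leq_add.
    rewrite (eq_bigl (fun lam => [&& vt lam == v, Some lam != f & lam \notin F]));
      last by move=> lam; rewrite andbT andbA.
    by apply: leq_sum => lam _; exact: IH.
  rewrite big_mkcond [X in _ <= X]big_mkcond /=; apply: leq_sum => lam _.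
  rewrite andbT; case: (lam \in F); last by rewrite andbF.
  rewrite andbT eq_sym; case: (v == vt lam) => //=; case: (Some lam != f) => //.
  by rewrite mul1n; exact: nbg_None.
rewrite big_split /= -addnA leq_add2l.
rewrite [X in _ <= X]big_ord_recl addnC leq_add //; first by rewrite subSS subn0.
rewrite exchange_big /=; apply: leq_sum => i _.
rewrite exchange_big /=; apply: leq_sum => lam' _.
rewrite subSS -big_distrl /= leq_mul2r; apply/orP; right.
rewrite big_mkcond [X in _ <= X]big_mkcond /=; apply: leq_sum => lam _.
by case: (vt lam == v) => //=; case: (Some lam != f) => //=; case: (lam \in F).
Qed.

(** No walk avoids the hitting set, so each one is cut at its first port in [F]: at most [K]
    positions, at most [s] ports, and two shorter pieces for the induction. *)
Theorem nbg_bound (K s : nat) :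
  (forall v t, exists F : seq P, size F <= s /\
    forall p, p != [::] -> size p <= K -> nbchain m v None p t -> has (mem F) p) ->
  forall k v f t, k <= K -> nbg [::] k v f t <= (K * s) ^ k.
Proof.
move=> HF; elim/ltn_ind => k IH v f t kK.
apply: leq_trans (nbg_None _ _ _ _ _) _.
case: k IH kK => [|k] IH kK; first by rewrite /= leq_b1.
have [F [sF hF]] := HF v t.
apply: leq_trans (nbg_split F _ _ _ _) _.
have -> : nbg F k.+1 v None t = 0.
  apply/eqP; rewrite -leqn0 leqNgt; apply/negP => /nbg_gt0 [p [p1 p2 /negP]]; apply.
  by apply: hF => //; rewrite ?p1 // -size_eq0 p1.
rewrite add0n.
apply: (@leq_trans (\sum_(i < k.+1) \sum_(lam in F) (K * s) ^ k)).
  apply: leq_sum => i _; apply: leq_sum => lam _.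
  case: i => i /= ik; rewrite subSS.
  have -> : (K * s) ^ k = (K * s) ^ i * (K * s) ^ (k - i) by rewrite -expnD subnKC.
  by rewrite leq_mul // IH //; lia.
rewrite !sum_nat_const card_ord expnS mulnA leq_mul2r; apply/orP; right.
by rewrite leq_mul // (leq_trans (card_size _)).
Qed.

End Counting.
End Walks.

(** * The tree and its matching *)

Section Tree.
Variables (h L La N : nat).
Hypothesis N_gt0 : 0 < N.
Hypothesis La_gt0 : 0 < La.

Definition nports := N * 2 ^ h.+1.
Definition top := L + h.+1 + La.
Definition sh (y : nat) := minn (y - L) h.+1.

Lemma sh0 : sh 0 = 0. Proof. by rewrite /sh sub0n min0n. Qed.

Lemma sh_le y : sh y <= h.+1. Proof. exact: geq_minr. Qed.

Lemma leq_shS y : sh y <= sh y.+1.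
Proof. by rewrite /sh; lia. Qed.

Lemma shS_mid y : L <= y -> y < L + h.+1 -> sh y.+1 = (sh y).+1.
Proof. by rewrite /sh; lia. Qed.

Lemma shS_low y : y < L -> sh y.+1 = sh y.
Proof. by rewrite /sh; lia. Qed.

(* The node at height y whose descending leaves are those with label in
   [l 2^(sh y), (l + 1) 2^(sh y)): a stem below height L, a binary tree of depth
   h + 1 above it, then a path up to the spine at height top. *)
Definition node := {p : 'I_top.+1 * 'I_nports | p.2 * 2 ^ sh p.1 < nports}.

Definition ht (x : node) : nat := (val x).1.
Definition lab (x : node) : 'I_nports := (val x).2.

Lemma nports_gt0 : 0 < nports.
Proof. by rewrite muln_gt0 N_gt0 expn_gt0. Qed.

Lemma node0_subproof : (Ordinal nports_gt0 : nat) * 2 ^ sh (ord0 : 'I_top.+1) < nports.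
Proof. by rewrite mul0n nports_gt0. Qed.

Definition node0 : node := exist _ (ord0, Ordinal nports_gt0) node0_subproof.

Definition mkn (y l : nat) : node :=
  insubd node0 (inord y, insubd (Ordinal nports_gt0) l).

Lemma node_inj x y : ht x = ht y -> lab x = lab y :> nat -> x = y.
Proof.
move=> H1 H2; apply: val_inj.
move: H1 H2; rewrite /ht /lab; case: (val x) => a b; case: (val y) => c d /= H1 H2.
by congr pair; apply: val_inj.
Qed.

Lemma ht_le x : ht x <= top.
Proof. by rewrite -ltnS /ht; exact: ltn_ord. Qed.

Lemma labP x : lab x * 2 ^ sh (ht x) < nports.
Proof. exact: (valP x). Qed.

Lemma mknP y l : y <= top -> l * 2 ^ sh y < nports ->
  ht (mkn y l) = y /\ lab (mkn y l) = l :> nat.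
Proof.
move=> yt lP.
have l1 : l < nports by apply: leq_ltn_trans lP; rewrite leq_pmulr // expn_gt0.
have E : val (mkn y l) = (inord y, insubd (Ordinal nports_gt0) l).
  rewrite /mkn val_insubd; case: ifP => // /negP [].
  by rewrite /= inordK // val_insubd l1.
by rewrite /ht /lab E /= inordK // val_insubd l1.
Qed.

Lemma mkn_eta x : mkn (ht x) (lab x) = x.
Proof. by have [H1 H2] := mknP (ht_le x) (labP x); apply: node_inj. Qed.

(** At height [top] the nodes form the spine, a path directed towards label 0, whose last node is
    its own parent; [tadj] discards that loop. *)
Definition par (x : node) : node :=
  if ht x < top then mkn (ht x).+1 (lab x %/ 2 ^ (sh (ht x).+1 - sh (ht x)))
  else mkn top (lab x).-1.

Lemma par_low x : ht x < top -> ht (par x) = (ht x).+1 /\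
  lab (par x) = lab x %/ 2 ^ (sh (ht x).+1 - sh (ht x)) :> nat.
Proof.
move=> H; rewrite /par H; apply: mknP => //.
apply: leq_ltn_trans (labP x).
have := leq_shS (ht x); set s := sh (ht x); set s' := sh _ => ss.
have -> : s' = (s' - s) + s by lia.
rewrite expnD mulnA leq_mul2r; apply/orP; right.
have -> : (s' - s + s - s) = s' - s by lia.
exact: leq_trunc_div.
Qed.

Lemma par_top x : ht x = top -> ht (par x) = top /\ lab (par x) = (lab x).-1 :> nat.
Proof.
move=> H; rewrite /par H ltnn; apply: mknP => //.
apply: leq_ltn_trans (labP x); rewrite H leq_mul2r; apply/orP; right.
exact: leq_pred.
Qed.

Lemma ht_par_le x : ht x <= ht (par x).
Proof.
have [H|H] := ltnP (ht x) top; first by have [-> _] := par_low H.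
have E : ht x = top by have := ht_le x; lia.
by have [-> _] := par_top E; rewrite E.
Qed.

Lemma vtx_subproof x : lab x %/ 2 ^ (h.+1 - sh (ht x)) < N.
Proof.
rewrite ltn_divLR ?expn_gt0 //.
have E : nports = N * 2 ^ (h.+1 - sh (ht x)) * 2 ^ sh (ht x).
  by rewrite -mulnA -expnD subnK // sh_le.
by rewrite -(ltn_pmul2r (expn_gt0 2 (sh (ht x)))) -E labP.
Qed.

Definition vtx (x : node) : 'I_N := Ordinal (vtx_subproof x).

Lemma vtx_par x : ht x < top -> vtx (par x) = vtx x.
Proof.
move=> H; have [E1 E2] := par_low H; apply: val_inj; rewrite /= E1 E2.
rewrite -divnMA -expnD; congr (_ %/ 2 ^ _).
by have := leq_shS (ht x); have := sh_le (ht x).+1; lia.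
Qed.

Definition leaf (lam : 'I_nports) : node := mkn 0 lam.

Lemma leafP lam : ht (leaf lam) = 0 /\ lab (leaf lam) = lam.
Proof.
have [||H1 H2] := @mknP 0 lam => //; first by rewrite sh0 muln1.
by split=> //; apply: val_inj.
Qed.

Lemma leaf_lab x : ht x = 0 -> leaf (lab x) = x.
Proof. by move=> H; have := mkn_eta x; rewrite H. Qed.

Lemma leaf_inj : injective leaf.
Proof. by move=> a b E; rewrite -(proj2 (leafP a)) E (proj2 (leafP b)). Qed.

Lemma vt_subproof (lam : 'I_nports) : lam %/ 2 ^ h.+1 < N.
Proof. by rewrite ltn_divLR ?expn_gt0. Qed.

Definition vt (lam : 'I_nports) : 'I_N := Ordinal (vt_subproof lam).

Lemma vtx_leaf lam : vtx (leaf lam) = vt lam.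
Proof.
apply: val_inj; rewrite /=; have [-> ->] := leafP lam.
by rewrite sh0 subn0.
Qed.

Local Notation anc i x := (iter i par x).

Lemma ht_anc i x : ht x + i <= top -> ht (anc i x) = ht x + i /\ vtx (anc i x) = vtx x.
Proof.
elim: i => [|i IH] H; first by rewrite addn0.
have [|E1 E2] := IH; first lia.
have H' : ht (anc i x) < top by rewrite E1; lia.
by rewrite iterS vtx_par // E2 (proj1 (par_low H')) E1 addnS.
Qed.

Lemma anc_lt i x : ht (anc i x) < top -> ht (anc i x) = ht x + i /\ vtx (anc i x) = vtx x.
Proof.
elim: i => [|i IH] H; first by rewrite addn0.
have H1 : ht (anc i x) < top by apply: leq_ltn_trans H; rewrite iterS ht_par_le.
have [E1 E2] := IH H1; apply: ht_anc; lia.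
Qed.

Lemma anc_stem i lam : i <= L -> ht (anc i (leaf lam)) = i /\ lab (anc i (leaf lam)) = lam.
Proof.
elim: i => [|i IH] H; first exact: leafP.
have [|E1 E2] := IH; first lia.
have H' : ht (anc i (leaf lam)) < top by rewrite E1 /top; lia.
have [F1 F2] := par_low H'; rewrite iterS; split; first by rewrite F1 E1.
by apply: val_inj; rewrite /= F2 E1 E2 shS_low // subnn divn1.
Qed.

(** The stems are disjoint; this is what makes consecutive crossings of the matching far apart in
    time. *)
Lemma anc_meet i lam mu : lam != mu -> anc i (leaf lam) = anc i (leaf mu) -> L < i.
Proof.
move=> /eqP ne E; rewrite ltnNge; apply/negP => iL; apply: ne.
by have [_ <-] := anc_stem lam iL; have [_ <-] := anc_stem mu iL; rewrite E.
Qed.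

Variable m : {perm 'I_nports}.
Hypothesis mm : matching m.

Definition tadj (x y : node) : bool := (x != y) &&
  [|| par x == y, par y == x | [&& ht x == 0, ht y == 0 & lab y == m (lab x)]].

Lemma tadj_sym : symmetric tadj.
Proof.
have mE (a b : 'I_nports) : (a == m b) = (b == m a).
  by apply/eqP/eqP => ->; rewrite matchingK.
move=> x y; rewrite /tadj eq_sym; congr (_ && _).
rewrite orbCA; congr (_ || (_ || _)).
by rewrite andbCA mE.
Qed.

Lemma tadj_irrefl : irreflexive tadj.
Proof. by move=> x; rewrite /tadj eqxx. Qed.

Definition tgraph : sgraph := SGraph tadj_sym tadj_irrefl.

Lemma par_neq (x : node) : ht x < top -> x != par x.
Proof.
move=> H; apply/eqP => E; have [H1 _] := par_low H.
by move: H1; rewrite -E; lia.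
Qed.

Lemma adj_par (x : node) : ht x < top -> tadj x (par x).
Proof. by move=> H; rewrite /tadj par_neq // eqxx. Qed.

Lemma adj_cross lam : tadj (leaf lam) (leaf (m lam)).
Proof.
have [H1 H2] := leafP lam; have [H3 H4] := leafP (m lam).
rewrite /tadj H1 H2 H3 H4 !eqxx !orbT andbT.
by rewrite (inj_eq leaf_inj) eq_sym matching_neq.
Qed.

Lemma adj_cases c n : tadj c n ->
  [\/ n = par c, par n = c | ht c = 0 /\ n = leaf (m (lab c))].
Proof.
move=> /andP[_ /or3P[/eqP->|/eqP<-|/and3P[/eqP h0 /eqP h1 /eqP E]]].
- exact: Or31.
- exact: Or32.
by apply: Or33; rewrite -E leaf_lab.
Qed.

Lemma tgraph_connected : graph_connected tgraph.
Proof.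
have csym : connect_sym (@adj tgraph) by exact: (sym_connect_sym tadj_sym).
pose root := mkn top 0.
have [rt0 rl0] : ht root = top /\ lab root = 0 :> nat.
  by apply: mknP => //; rewrite mul0n nports_gt0.
suff toroot x : connect (@adj tgraph) x root.
  by move=> x y; apply: connect_trans (toroot x) _; rewrite csym.
(* A step to the parent either gains height without raising the label or, on the spine, lowers the
   label. *)
have [k] := ubnP ((top - ht x) + lab x); elim: k x => [//|k IH] x Hk.
have [H|H] := ltnP (ht x) top.
  have [E1 E2] := par_low H.
  apply: connect_trans (connect1 (adj_par H)) _; apply: IH.
  rewrite E1; have : lab (par x) <= lab x by rewrite E2 leq_div.
  lia.
have E : ht x = top by have := ht_le x; lia.
have [l0|l0] := posnP (lab x).
  by have -> : x = root by apply: node_inj; rewrite ?E ?l0.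
have [E1 E2] := par_top E.
have ax : tadj x (par x).
  rewrite /tadj eqxx andbT; apply/eqP => F; have : lab x = lab (par x) :> nat by rewrite -F.
  by rewrite E2; lia.
apply: connect_trans (connect1 ax) _; apply: IH.
by rewrite E1 E2; lia.
Qed.

Lemma tgraph_subcubic : subcubic tgraph.
Proof.
move=> x; rewrite /degree.
have [h0|h0] := posnP (ht x).
  apply: (@leq_trans #|[set par x; leaf (m (lab x))]|); last first.
    by rewrite cards2; case: (_ != _).
  apply: subset_leq_card; apply/subsetP => y; rewrite !inE => /adj_cases [->|E|[_ ->]].
  - by rewrite eqxx.
  - by have := ht_par_le y; have := ht_le y; rewrite E h0 => _ ?;
      have H : ht y < top by [rewrite /top; lia]; have [] := par_low H; rewrite E h0.
  - by rewrite eqxx orbT.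
(* The candidates for preimages of [x] under [par]. Two nodes below occur only where [d = 1], in a
   binary tree; on the spine [La_gt0] gives [d = 0], so one node below leaves room for the next
   spine node. *)
pose d := sh (ht x) - sh (ht x).-1.
pose c1 := mkn (ht x).-1 (2 ^ d * lab x).
pose c2 := if ht x == top then mkn top (lab x).+1 else mkn (ht x).-1 (2 ^ d * lab x).+1.
apply: (@leq_trans #|[set par x; c1; c2]|); last first.
  by apply: leq_trans (leq_card_setU _ _) _; rewrite cards1 cards2; case: (_ != _).
apply: subset_leq_card; apply/subsetP => y.
rewrite !inE -orbA => /adj_cases [->|E|[E]]; [by rewrite eqxx| |by rewrite E in h0].
have [H|H] := ltnP (ht y) top.
  have [E1 E2] := par_low H; rewrite E in E1 E2.
  have hy : (ht x).-1 = ht y by rewrite E1.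
  rewrite -E1 -hy -/d in E2.
  have d1 : d <= 1 by rewrite /d /sh; lia.
  have Ey := mkn_eta y; rewrite -hy in Ey.
  have Ediv := divn_eq (lab y) (2 ^ d); rewrite -E2 mulnC in Ediv.
  have md : lab y %% 2 ^ d < 2 ^ d by rewrite ltn_mod expn_gt0.
  have [mod0|mod0] := posnP (lab y %% 2 ^ d).
    rewrite mod0 addn0 in Ediv.
    by apply/orP; right; apply/orP; left; rewrite /c1 -Ediv Ey.
  have dE : d = 1 by move: md mod0; case: (d) d1 => [|[|]] //=; rewrite ?expn0; lia.
  apply/orP; right; apply/orP; right; rewrite /c2.
  have -> : (ht x == top) = false.
    apply/eqP => xt; move: dE; rewrite /d xt /top /sh; lia.
  have -> : (2 ^ d * lab x).+1 = lab y.
    by rewrite Ediv; move: md mod0; rewrite dE; lia.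
  by rewrite Ey.
have yt : ht y = top by have := ht_le y; lia.
have [E1 E2] := par_top yt; rewrite E in E1 E2.
have [l0|l0] := posnP (lab y).
  apply/orP; left; apply/eqP; apply: node_inj; rewrite ?(proj1 (par_top E1)) //.
  by rewrite (proj2 (par_top E1)) E2 l0.
apply/orP; right; apply/orP; right; rewrite /c2 E1 eqxx E2 prednK //.
by have := mkn_eta y; rewrite yt => ->.
Qed.

Lemma low_degree : exists x : tgraph, degree x <= 2.
Proof.
exists (leaf (Ordinal nports_gt0)); set x := leaf _; rewrite /degree.
have h0 : ht x = 0 by case: (leafP (Ordinal nports_gt0)).
apply: (@leq_trans #|[set par x; leaf (m (lab x))]|); last first.
  by rewrite cards2; case: (_ != _).
apply: subset_leq_card; apply/subsetP => y; rewrite !inE => /adj_cases [->|E|[_ ->]].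
- by rewrite eqxx.
- by have := ht_par_le y; rewrite E h0 => ?;
    have H : ht y < top by [rewrite /top; lia]; have [] := par_low H; rewrite E h0.
- by rewrite eqxx orbT.
Qed.

Lemma card_tgraph : #|tgraph| <= top.+1 * nports.
Proof.
rewrite (@leq_trans #|{: 'I_top.+1 * 'I_nports}|) //; last by rewrite card_prod !card_ord.
by rewrite -(card_codom (@val_inj _ _ _)) max_card.
Qed.

(** * Counting nonbacktracking walks in the tree with its matching *)

Lemma sum_nbrs (F : node -> nat) (p c : tgraph) :
  \sum_(n | adj c n && (n != p)) F n <= (par c != p) * F (par c) +
    \sum_(n | [&& adj c n, n != p & par n == c]) F n +
    (if (ht c == 0) && (leaf (m (lab c)) != p) then F (leaf (m (lab c))) else 0).
Proof.
rewrite big_mkcond /=.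
apply: (@leq_trans (\sum_n ((if n == par c then (par c != p) * F (par c) else 0) +
   (if [&& tadj c n, n != p & par n == c] then F n else 0) +
   (if n == leaf (m (lab c)) then
     (if (ht c == 0) && (leaf (m (lab c)) != p) then F (leaf (m (lab c))) else 0)
    else 0)))).
  apply: leq_sum => n _.
  case: ifP => // /andP[a np]; rewrite a np /=.
  case: (adj_cases a) => [E|E|[E1 E2]].
  - by rewrite E eqxx -E np mul1n -addnA leq_addr.
  - by rewrite E eqxx -addnA addnCA leq_addr.
  - by rewrite E2 eqxx -E2 E1 np /= leq_addl.
rewrite !big_split /= -!big_mkcond /= !big_pred1_eq.
by rewrite leq_add2r leq_add2l.
Qed.

(* walks that just crossed the matching and arrived at the leaf mu *)
Definition arr (r : nat) (mu : 'I_nports) (x : tgraph) : nat :=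
  nbw r (leaf (m mu) : tgraph) (leaf mu) x.

Lemma arr_mate r lam x : arr r (m lam) x = nbw r (leaf lam : tgraph) (leaf (m lam)) x.
Proof. by rewrite /arr matchingK. Qed.

(** After coming from its parent a walk can only descend until it crosses. Either it is still
    descending at the end, so [c] is the [r]-th ancestor of [x], or it crosses at a leaf [lam] lying
    [j] levels below [c]. *)
Lemma nbw_down r (p c x : tgraph) : par c = p ->
  nbw r p c x <= (anc r x == c) +
    \sum_(j < r) \sum_(lam | anc j (leaf lam) == c) arr (r - j.+1) (m lam) x.
Proof.
elim: r p c => [|r IH] p c pc; first by rewrite big_ord0 addn0 /= eq_sym.
rewrite [nbw _ _ _ _]/=; apply: leq_trans (sum_nbrs _ _ _) _.
rewrite pc eqxx mul0n add0n big_ord_recl subn1 addnCA addnC leq_add //.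
  case: ifP => [/andP[/eqP c0 _]|//].
  rewrite (bigD1 (lab c)) /=; last by rewrite leaf_lab.
  by rewrite arr_mate leaf_lab // leq_addr.
apply: (@leq_trans (\sum_(n | par n == c) ((anc r x == n) +
    \sum_(j < r) \sum_(lam | anc j (leaf lam) == n) arr (r - j.+1) (m lam) x))).
  rewrite big_mkcond [X in _ <= X]big_mkcond /=; apply: leq_sum => n _.
  case: ifP => [/and3P[_ _ /eqP E]|_ //]; rewrite E eqxx.
  exact: IH.
rewrite big_split /= leq_add //.
  rewrite big_mkcond /= (bigD1 (anc r x)) //= eqxx [X in _ + X]big1 ?addn0.
    by case: (_ == _).
  by move=> n /negPf nn; rewrite (eq_sym (anc r x)) nn; case: ifP.
rewrite exchange_big /=; apply: leq_sum => j _.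
rewrite (exchange_big_dep (fun lam => par (anc j (leaf lam)) == c)) /=.
  apply: leq_sum => lam E; rewrite subSS.
  rewrite (eq_bigl (pred1 (anc j (leaf lam)))) ?big_pred1_eq //.
  move=> n /=; rewrite (eq_sym (anc j _)).
  by have [->|_] := eqVneq n (anc j (leaf lam)); rewrite ?E ?andbF.
by move=> n lam /eqP E1 /eqP E2; apply/eqP; congruence.
Qed.

(** The walk climbs [s] more levels, turns and descends. If it never crosses, [x] and the turning
    height determine it, which leaves at most [r + 1] walks. Otherwise it crosses at another leaf of
    the same tree with its step number [i + 2 s + 1], and meeting another leaf needs a turning
    height above [L]. The bound on [i + r] keeps it off the spine. *)
Lemma nbw_up r i mu (x : tgraph) : i + r < top ->
  nbw r (if i is i'.+1 then anc i' (leaf mu) else leaf (m mu) : tgraph) (anc i (leaf mu)) x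
  <= r.+1 * (vtx x == vt mu) +
    \sum_(s < r) (if (L < i + s) && (i + s + s < r) then
      \sum_(lam | (vt lam == vt mu) && (lam != mu)) arr (r - (i + s + s).+1) (m lam) x
      else 0).
Proof.
elim: r i => [|r IH] i H.
  rewrite big_ord0 addn0 mul1n /=.
  have [|E1 E2] := @ht_anc i (leaf mu); first by rewrite (proj1 (leafP _)); lia.
  by case: eqP => // E; rewrite -E E2 vtx_leaf eqxx.
have [|hc vc] := @ht_anc i (leaf mu); first by rewrite (proj1 (leafP _)); lia.
rewrite (proj1 (leafP _)) add0n in hc; rewrite vtx_leaf in vc.
set c := anc i (leaf mu) in hc vc *.
set p := if i is i'.+1 then _ else _.
rewrite [nbw _ _ _ _]/=; apply: leq_trans (sum_nbrs _ _ _) _.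
have -> : (if (ht c == 0) && (leaf (m (lab c)) != p) then
   nbw r (c : tgraph) (leaf (m (lab c))) x else 0) = 0.
  rewrite hc; case: (i) @p @c hc vc => [|i'] //= _ _.
  by rewrite (proj2 (leafP mu)) eqxx.
rewrite addn0 big_ord_recl mulSn [X in _ <= X]addnACA.
rewrite [X in _ <= X]addnC; apply: leq_add.
  have [|_] := boolP (par c != p); last by rewrite mul0n.
  move=> _; rewrite mul1n.
  have := IH i.+1; rewrite /= -/c => IHi.
  apply: leq_trans (IHi _) _; first lia.
  rewrite leq_add2l; apply: leq_sum => s _ /=.
  rewrite /bump /= add1n.
  have -> : (L < i.+1 + s) && (i.+1 + s + s < r) = (L < i + s.+1) && (i + s.+1 + s.+1 < r.+1).
    by apply/idP/idP; lia.
  by have -> : r.+1 - (i + s.+1 + s.+1).+1 = r - (i.+1 + s + s).+1 by lia.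
have le1 (n : tgraph) : [&& adj (c : tgraph) n, n != p & par n == c] ->
    nbw r (c : tgraph) n x <= (anc r x == n) +
    \sum_(j < r) \sum_(lam | anc j (leaf lam) == n) arr (r - j.+1) (m lam) x.
  by move=> /and3P[_ _ /eqP E]; exact: nbw_down.
apply: leq_trans (leq_sum _ le1) _.
rewrite big_split /= leq_add //.
  rewrite big_mkcond /= (bigD1 (anc r x)) //= eqxx [X in _ + X]big1 ?addn0; last first.
    by move=> n /negPf nn; rewrite (eq_sym (anc r x)) nn; case: ifP.
  case: ifP => // /and3P[_ _ /eqP E].
  have [|_ E2] := @anc_lt r.+1 x; first by rewrite iterS E hc; lia.
  by rewrite -E2 iterS E vc eqxx.
rewrite !addn0.
clear le1; case: i @c @p hc vc H => [|i] c p hc vc H.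
  rewrite big1 // => n /and3P[_ _ /eqP E]; exfalso.
  have := ht_par_le n; rewrite E hc => ?.
  have Hn : ht n < top by rewrite /top; lia.
  by have [] := par_low Hn; rewrite E hc.
rewrite exchange_big /=.
have htn n : par n = c -> ht n = i.
  move=> E; have := ht_par_le n; rewrite E hc => ?.
  have Hn : ht n < top by lia.
  by have [] := par_low Hn; rewrite E hc => -[].
(* Height determines the distance to the leaves, so only the term [j = i] survives. *)
have hl j lam n : par n = c -> anc j (leaf lam) = n -> j = i.
  move=> /htn E1 E2; have [|] := @anc_lt j (leaf lam); first by rewrite E2 E1; lia.
  by rewrite E2 E1 (proj1 (leafP _)).
have [ir|ir] := ltnP i r; last first.
  rewrite big1 // => j _; rewrite big1 // => n /and3P[_ _ /eqP E]; rewrite big1 //.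
  by move=> lam /eqP F; have := hl _ _ _ E F; have := ltn_ord j; lia.
rewrite (bigD1 (Ordinal ir)) //= [X in _ + X]big1 ?addn0; last first.
  move=> j /eqP ji; rewrite big1 // => n /and3P[_ _ /eqP E]; rewrite big1 //.
  move=> lam /eqP F; case: ji; apply: val_inj; exact: (hl _ _ _ E F).
have good lam n : n != p -> par n = c -> anc i (leaf lam) = n ->
    [/\ vt lam = vt mu, lam != mu & L < i.+1].
  move=> np E F.
  have nl : lam != mu by apply: contraNneq np => E3; rewrite -F E3.
  have EE : anc i.+1 (leaf lam) = anc i.+1 (leaf mu) by rewrite iterS F E.
  split=> //; last exact: anc_meet nl EE.
  have [|_] := @anc_lt i.+1 (leaf lam); first by rewrite EE -/c hc; lia.
  by rewrite EE -/c vc vtx_leaf.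
have [Li|Li] := ltnP L i.+1; last first.
  rewrite big1 // => n /and3P[_ np /eqP E]; rewrite big1 // => lam /eqP F.
  by have [_ _] := good _ _ np E F; lia.
rewrite ltnS ir /= subSS.
rewrite (exchange_big_dep (fun lam => (vt lam == vt mu) && (lam != mu))) /=; last first.
  by move=> n lam /and3P[_ np /eqP E] /eqP F; have [-> -> _] := good _ _ np E F; rewrite eqxx.
apply: leq_sum => lam _.
rewrite big_mkcond /= (bigD1 (anc i (leaf lam))) //= [X in _ + X]big1 ?addn0.
  by case: ifP.
by move=> n /negPf nn; rewrite (eq_sym (anc i _)) nn andbF.
Qed.

Local Notation gwalks k v f w := (nbg vt m [::] k v f w).

(** Contracting the trees sends a walk with [k] crossings to one counted by [gwalks k]; each of its
    [k + 1] stretches admits at most [Rm] turning heights. Between crossings it climbs above [L] and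
    returns, so a crossing takes at least [2 L + 3] steps. *)
Lemma arr_bound (Rm Km : nat) : Rm <= top -> Rm <= Km * (L.*2 + 3) ->
  forall r mu (x : tgraph), r < Rm ->
  arr r mu x <= \sum_(k < Km) (if k * (L.*2 + 3) <= r then
     Rm ^ k.+1 * gwalks k (vt mu) (Some mu) (vtx x) else 0).
Proof.
move=> Rtop RK; elim/ltn_ind => r IH mu x rR.
have := @nbw_up r 0 mu x.
rewrite /= -/(arr r mu x) => HU; apply: leq_trans (HU _) _; first lia.
case: Km RK IH => [|Km] RK IH; first by move: RK; rewrite mul0n; lia.
rewrite big_ord_recl /= expn1 [_ == vtx x]eq_sym leq_add ?leq_mul2r ?rR ?orbT //.
apply: (@leq_trans (\sum_(s < r) \sum_(k < Km) (if k.+1 * (L.*2 + 3) <= r then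
     Rm ^ k.+1 * gwalks k.+1 (vt mu) (Some mu) (vtx x) else 0))); last first.
  rewrite sum_nat_const card_ord big_distrr /=; apply: leq_sum => k _.
  rewrite /bump add1n; case: ifP => _; last by rewrite muln0.
  by rewrite [Rm ^ k.+2]expnS -mulnA leq_mul2r ltnW ?orbT.
apply: leq_sum => s _; case: ifP => // /andP[Ls sr]; rewrite add0n in Ls sr.
apply: (@leq_trans (\sum_(lam | (vt lam == vt mu) && (lam != mu))
   \sum_(k < Km.+1) (if k * (L.*2 + 3) <= r - (0 + s + s).+1 then
     Rm ^ k.+1 * gwalks k (vt (m lam)) (Some (m lam)) (vtx x) else 0))).
  by apply: leq_sum => lam _; apply: IH; lia.
rewrite exchange_big /= big_ord_recr /= [X in _ + X]big1 ?addn0; last first.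
  move=> lam _; case: ifP => // H; exfalso.
  have : Km.+1 * (L.*2 + 3) <= r by rewrite mulSn; lia.
  lia.
apply: leq_sum => k _.
have [H|H] := leqP (k * (L.*2 + 3)) (r - (0 + s + s).+1); last by rewrite big1.
have -> : k.+1 * (L.*2 + 3) <= r by rewrite mulSn; lia.
rewrite -big_distrr /= leq_mul2l; apply/orP; right.
by rewrite [X in _ <= X](eq_bigl (fun lam => (vt lam == vt mu) && (lam != mu))) // => lam;
  rewrite andbT.
Qed.

(** * The periodic route of the robber and her starting positions *)

Lemma stem_child c : 0 < ht c -> ht c <= L ->
  exists2 n, par n = c & ht n = (ht c).-1.
Proof.
move=> c0 cL.
have [||H1 H2] := @mknP (ht c).-1 (lab c).
- by have := ht_le c; lia.
- by rewrite -(shS_low (y := (ht c).-1)) ?prednK ?labP //; lia.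
exists (mkn (ht c).-1 (lab c)) => //.
have [|E1 E2] := @par_low (mkn (ht c).-1 (lab c)); first by have := ht_le c; lia.
apply: node_inj; first by rewrite E1 H1 prednK.
by rewrite E2 H1 H2 shS_low ?subnn ?divn1 //; lia.
Qed.

Lemma two_children c : L < ht c -> ht c <= L + h.+1 -> exists n1 n2,
  [/\ n1 != n2, par n1 = c, par n2 = c, ht n1 = (ht c).-1 & ht n2 = (ht c).-1].
Proof.
move=> cL cH; set y := (ht c).-1; set l := lab c : nat.
have yE : ht c = y.+1 by rewrite /y prednK //; lia.
have shE : sh y.+1 = (sh y).+1 by apply: shS_mid; lia.
have child b : b < 2 ->
    [/\ ht (mkn y (l * 2 + b)) = y, lab (mkn y (l * 2 + b)) = l * 2 + b :> nat &
      par (mkn y (l * 2 + b)) = c].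
  move=> b2; have [||H1 H2] := @mknP y (l * 2 + b).
  - by have := ht_le c; lia.
  - have E : nports = N * 2 ^ (h.+1 - (sh y).+1) * 2 ^ (sh y).+1.
      by rewrite -mulnA -expnD subnK // -shE sh_le.
    have := labP c; rewrite -/l yE shE [X in _ < X]E ltn_pmul2r ?expn_gt0 // => lN.
    apply: (@leq_trans (l.+1 * 2 ^ (sh y).+1)).
      by rewrite expnS mulnA ltn_pmul2r ?expn_gt0 //; lia.
    by rewrite E leq_mul2r lN orbT.
  split=> //.
  have [|E1 E2] := @par_low (mkn y (l * 2 + b)); first by have := ht_le c; lia.
  apply: node_inj; first by rewrite E1 H1 yE.
  rewrite E2 H1 H2 shE subSnn expn1 divnMDl //.
  by rewrite divn_small // addn0.
have [//|a1 a2 a3] := child 0; have [//|b1 b2 b3] := child 1.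
exists (mkn y (l * 2 + 0)), (mkn y (l * 2 + 1)); split=> //.
apply/eqP => E; have : lab (mkn y (l * 2 + 0)) = lab (mkn y (l * 2 + 1)) :> nat by rewrite E.
by rewrite a2 b2; lia.
Qed.

(** From a child of a root, [L + h] steps descend to a leaf, one crosses, [L + h + 1] climb to the
    root of the new tree, and one enters its other half. *)
Definition period := (L + h).*2.+3.

Definition phase (i : nat) (p c : tgraph) : Prop :=
  if i <= L + h then ht c = L + h - i /\ p = par c
  else ht c = i - (L + h).+1 /\ par c <> p.

Lemma adj_child (n c : node) : par n = c -> ht n < top -> tadj c n.
Proof. by move=> <- H; rewrite tadj_sym adj_par. Qed.

Lemma child_neq_par (n c : node) : ht n = (ht c).-1 -> 0 < ht c -> ht c < top ->
  n != par c.
Proof.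
move=> H1 H2 H3; apply/eqP => E; have [H4 _] := par_low H3.
by move: H1; rewrite E H4; lia.
Qed.

Lemma phase_one i (p c : tgraph) : i < period -> phase i p c ->
  exists2 n : tgraph, adj c n && (n != p) & phase (if i.+1 == period then 0 else i.+1) c n.
Proof.
rewrite /phase /period => iT.
have tE : L + h.+1 < top by rewrite /top; lia.
have [iL|iL] := leqP i (L + h) => -[hc pc].
  have -> : (i.+1 == (L + h).*2.+3) = false by apply/eqP; lia.
  rewrite /=.
  have [iE|iE] := ltnP i (L + h).
    have [n En hn] : exists2 n, par n = c & ht n = (ht c).-1.
      have [cL|cL] := leqP (ht c) L; first by apply: stem_child => //; lia.
      have [|n1 [n2 [_ H1 _ H2 _]]] := two_children cL; first lia.
      by exists n1.
    exists n; last by split; [lia | rewrite En].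
    apply/andP; split; first by apply: adj_child => //; lia.
    by rewrite pc child_neq_par //; lia.
  have c0 : ht c = 0 by lia.
  have [H1 H2] := leafP (m (lab c)).
  have ct : ht c < top by lia.
  have [P1 _] := par_low ct.
  exists (leaf (m (lab c))).
    apply/andP; split; first by have := adj_cross (lab c); rewrite leaf_lab.
    by rewrite pc; apply/eqP => E; move: H1; rewrite E P1.
  split; first by rewrite H1; lia.
  have lt : ht (leaf (m (lab c))) < top by lia.
  by have [P2 _] := par_low lt => E; move: P2; rewrite E c0.
have ct : ht c < top by lia.
have [P1 _] := par_low ct.
case: eqP => iE; last first.
  exists (par c).
    by apply/andP; split; [exact: adj_par | apply/eqP].
  have -> : (i.+1 <= L + h) = false by apply/negbTE; lia.
  split; first by rewrite P1; lia.
  have pt : ht (par c) < top by lia.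
  by have [P2 _] := par_low pt => E; move: P2; rewrite E P1; lia.
have [||n1 [n2 [n12 E1 E2 h1 h2]]] := @two_children c; [lia|lia|].
have [n [np En hn]] : exists n, [/\ n != p, par n = c & ht n = (ht c).-1].
  have [n1p|n1p] := eqVneq n1 p; last by exists n1.
  by exists n2; rewrite -n1p eq_sym.
exists n; last by rewrite /=; split; [lia | rewrite En].
by apply/andP; split=> //; apply: adj_child => //; lia.
Qed.

Lemma phase_two i (p c : tgraph) : i < h -> phase i p c ->
  exists n1 n2 : tgraph, [/\ n1 != n2, adj c n1 && (n1 != p), adj c n2 && (n2 != p),
    phase i.+1 c n1 & phase i.+1 c n2].
Proof.
rewrite /phase => ih.
have tE : L + h.+1 < top by rewrite /top; lia.
have -> : i <= L + h by lia.
have -> : i.+1 <= L + h by lia.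
move=> [hc pc].
have [||n1 [n2 [n12 E1 E2 h1 h2]]] := @two_children c; [lia|lia|].
exists n1, n2; split=> //; try (by split; [lia | by []]);
  by apply/andP; split; [apply: adj_child => //; lia | rewrite pc child_neq_par //; lia].
Qed.

Lemma nbw_start r (p c x : tgraph) : phase 0 p c ->
  nbw r p c x <= (anc r x == c) + (if L + h < r then
    \sum_(lam | anc (L + h) (leaf lam) == c) arr (r - (L + h).+1) (m lam) x else 0).
Proof.
rewrite /phase leq0n subn0 => -[hc pc].
apply: leq_trans (nbw_down r x (esym pc)) _; rewrite leq_add2l.
have hj j lam : anc j (leaf lam) == c -> j = L + h.
  move=> /eqP E; have [|H _] := @anc_lt j (leaf lam); first by rewrite E hc /top; lia.
  by move: H; rewrite E hc (proj1 (leafP _)).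
case: ifP => Lr.
  rewrite (bigD1 (Ordinal Lr)) //= [X in _ + X]big1 ?addn0 // => j jn.
  rewrite big1 // => lam /hj E; move/eqP: jn; case; exact: val_inj.
rewrite big1 // => j _; rewrite big1 // => lam /hj E.
by have := ltn_ord j; rewrite E Lr.
Qed.

(** This supplies [cc_bound]. Summing over the leaves below [c] prepends the first crossing, so the
    walks are bounded by [gwalks] from the tree of [c] with one crossing more. *)
Lemma nbw_start_bound (Rm Km A : nat) (p c x : tgraph) :
  Rm <= top -> Rm <= Km * (L.*2 + 3) -> 0 < Rm -> 0 < A ->
  (forall k v f w, k <= Km -> gwalks k v f w <= A ^ k) ->
  phase 0 p c ->
  \sum_(r < Rm) nbw r p c x <= Rm * (1 + Km * (Rm ^ Km * A ^ Km)).
Proof.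
move=> Rtop RK R0 A0 HA ph.
rewrite -[X in _ <= X * _]card_ord -sum_nat_const; apply: leq_sum => r _.
apply: leq_trans (nbw_start _ _ ph) _; rewrite leq_add ?leq_b1 //.
case: ifP => // Lr.
have vc lam : anc (L + h) (leaf lam) == c -> vt lam == vtx c.
  move=> /eqP <-; have [|_ ->] := @ht_anc (L + h) (leaf lam).
    by rewrite (proj1 (leafP _)) /top; lia.
  by rewrite vtx_leaf.
apply: (@leq_trans (\sum_(lam | vt lam == vtx c) arr (r - (L + h).+1) (m lam) x)).
  rewrite big_mkcond [X in _ <= X]big_mkcond /=; apply: leq_sum => lam _.
  by case: ifP => // /vc ->.
apply: (@leq_trans (\sum_(lam | vt lam == vtx c) \sum_(k < Km)
   Rm ^ k.+1 * gwalks k (vt (m lam)) (Some (m lam)) (vtx x))).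
  apply: leq_sum => lam _; apply: leq_trans (arr_bound Rtop RK _ _ _) _.
    by have := ltn_ord r; lia.
  by apply: leq_sum => k _; case: ifP.
rewrite exchange_big /= -[X in _ <= X * _]card_ord -sum_nat_const.
apply: leq_sum => k _; rewrite -big_distrr /=.
apply: leq_mul; first by rewrite leq_pexp2l.
apply: (@leq_trans (gwalks k.+1 (vtx c) None (vtx x))).
  by rewrite /= [X in _ <= X](eq_bigl (fun lam => vt lam == vtx c)) // => lam; rewrite andbT.
by apply: leq_trans (HA _ _ _ _ _) _ => //; rewrite leq_pexp2l.
Qed.

Lemma port_subproof (v : 'I_N) (a : 'I_(2 ^ h.+1)) : v * 2 ^ h.+1 + a < nports.
Proof.
apply: (@leq_trans (v.+1 * 2 ^ h.+1)); first by rewrite mulSn addnC ltn_add2r.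
by rewrite /nports leq_mul2r ltn_ord orbT.
Qed.

Definition port v a : 'I_nports := Ordinal (port_subproof v a).

Lemma portP lam : exists a, port (vt lam) a = lam.
Proof.
have H : lam %% 2 ^ h.+1 < 2 ^ h.+1 by rewrite ltn_mod expn_gt0.
by exists (Ordinal H); apply: val_inj; rewrite /= -divn_eq.
Qed.

(** Read backwards from [w], a walk has at most [2 ^ h.+1] ports to choose from at each of its
    [k + 1] vertices. *)
Lemma sum_gwalks k w :
  \sum_mu gwalks k (vt mu) (Some mu) w <= (2 ^ h.+1) ^ k.+1.
Proof.
have cardv v : #|[set mu | vt mu == v]| <= 2 ^ h.+1.
  have := card_ports portP [:: v]; rewrite mul1n; apply: leq_trans.
  by apply: subset_leq_card; apply/subsetP => mu; rewrite !inE.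
elim: k => [|k IH].
  rewrite /= expn1; apply: leq_trans (cardv w).
  by rewrite -sum1dep_card [X in _ <= X]big_mkcond /=; apply: leq_sum => mu _; case: eqP.
apply: (@leq_trans (\sum_lam \sum_(mu | vt mu == vt lam)
    gwalks k (vt (m lam)) (Some (m lam)) w)).
  rewrite [X in _ <= X](exchange_big_dep predT) //=; apply: leq_sum => mu _.
  rewrite big_mkcond [X in _ <= X]big_mkcond /=; apply: leq_sum => lam _.
  by rewrite [vt mu == _]eq_sym; case: (_ == _) => //=; case: (Some _ != _).
rewrite [X in _ <= X]expnS.
apply: (@leq_trans (\sum_lam 2 ^ h.+1 * gwalks k (vt (m lam)) (Some (m lam)) w)).
  apply: leq_sum => lam _; rewrite sum_nat_const leq_mul2r; apply/orP; right.
  by have := cardv (vt lam); rewrite cardsE.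
rewrite -big_distrr /= leq_mul2l; apply/orP; right.
apply: leq_trans IH; rewrite [X in _ <= X](reindex_inj (@perm_inj _ m)) /=.
exact: leqnn.
Qed.

Definition start (v : 'I_N) : tgraph := mkn (L + h) (2 * v).

Lemma startP v : ht (start v) = L + h /\ vtx (start v) = v.
Proof.
have shE : sh (L + h) = h by rewrite /sh; lia.
have [||H1 H2] := @mknP (L + h) (2 * v); first by rewrite /top; lia.
  by rewrite shE /nports expnS mulnCA -mulnA ltn_pmul2l // ltn_pmul2r ?expn_gt0.
split=> //; apply: val_inj; rewrite /= H1 H2 shE subSnn expn1.
by rewrite mulKn.
Qed.

Lemma start_phase v : phase 0 (par (start v)) (start v).
Proof. by rewrite /phase leq0n subn0; split=> //; case: (startP v). Qed.

(** Each leaf hangs below at most one start, so the sum over [v] becomes a sum over all ports, to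
    which [sum_gwalks] applies. *)
Lemma sum_start_nbw r (Km Rm : nat) (x : tgraph) :
  Rm <= top -> Rm <= Km * (L.*2 + 3) -> r < Rm ->
  \sum_v nbw r (par (start v) : tgraph) (start v) x <= 1 +
    \sum_(k < Km) (if k * (L.*2 + 3) <= r then Rm ^ k.+1 * (2 ^ h.+1) ^ k.+1 else 0).
Proof.
move=> Rtop RK rR.
apply: leq_trans (leq_sum _ (fun v _ => nbw_start r x (start_phase v))) _.
rewrite big_split /= leq_add //.
  apply: (@leq_trans (\sum_v (v == vtx (anc r x)))).
    apply: leq_sum => v _; case: eqP => // ->.
    by rewrite (proj2 (startP v)) eqxx.
  rewrite (bigD1 (vtx (anc r x))) //= eqxx big1 ?addn0 // => v /negPf ->.
  by [].
have [Lr|_] := ltnP (L + h) r; last by rewrite big1.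
rewrite (exchange_big_dep predT) //=.
apply: (@leq_trans (\sum_lam arr (r - (L + h).+1) (m lam) x)).
  apply: leq_sum => lam _.
  rewrite sum_nat_const -[X in _ <= X]mul1n leq_mul2r; apply/orP; right.
  apply: (@leq_trans #|[set vtx (anc (L + h) (leaf lam))]|); last by rewrite cards1.
  apply: subset_leq_card; apply/subsetP => v vE.
  have /eqP -> : anc (L + h) (leaf lam) == start v := vE.
  by rewrite (proj2 (startP v)) inE.
rewrite -(reindex_inj (@perm_inj _ m) (P := xpredT) (F := fun mu => arr _ mu x)) /=.
apply: (@leq_trans (\sum_mu \sum_(k < Km) (if k * (L.*2 + 3) <= r then
     Rm ^ k.+1 * gwalks k (vt mu) (Some mu) (vtx x) else 0))).
  apply: leq_sum => mu _; apply: leq_trans (arr_bound Rtop RK _ _ _) _; first lia.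
  apply: leq_sum => k _; case: ifP => // H.
  by have -> : k * (L.*2 + 3) <= r by lia.
rewrite exchange_big /=; apply: leq_sum => k _; case: ifP => H; last by rewrite big1.
by rewrite -big_distrr /= leq_mul2l sum_gwalks orbT.
Qed.

(** * Constraints on the lengths, and evasion on the tree *)

Section Params.
Variable Q : nat.
Hypothesis h_gt0 : 0 < h.
Hypothesis hL : 4 * h * Q.+2 <= L.
Hypothesis LaE : wlen period Q <= La.

Let W := wlen period Q.
Let K := Q.*2 + 5.

(** [W] is [2 Q + 4] periods of [2 L + 3 + 2 h] steps each; by [hL] the total excess [4 h (Q + 2)]
    fits into one further [2 L + 3]. *)
Lemma wlen_le_crossings : W <= K * (L.*2 + 3).
Proof. by rewrite /W /K /wlen /period; move: hL; nia. Qed.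

Lemma wlen_le_top : W <= top.
Proof. by rewrite /W /top; lia. Qed.

Lemma wlen_gt0 : 0 < W.
Proof. by rewrite /W /wlen /period muln_gt0. Qed.

(** Two crossings take almost a block, so the decay of the weight offsets about half of the growth
    in the number of walks. Taking [k.-1./2] rather than [k./2] absorbs the [2 h] by which a period
    exceeds [2 L + 3]. *)
Lemma wt_crossings k r : k < K -> k * (L.*2 + 3) <= r ->
  wt period h Q r * (2 ^ h.+1) ^ k.+1 <= (2 ^ h.+1) ^ K.
Proof.
rewrite /K => kK kr.
have t1 : k.-1./2 <= r %/ period.*2.
  rewrite leq_divRL ?double_gt0 //; apply: leq_trans kr.
  case: k kK => [|k] kK /=; first by rewrite mul0n.
  have kE : k./2.*2 <= k by rewrite -[X in _ <= X]odd_double_half leq_addl.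
  have kQ : k./2 <= Q.+1 by lia.
  by rewrite /period; move: hL kE kQ; set t := k./2; nia.
rewrite /wt -!expnM -expnD leq_pexp2l //.
apply: (@leq_trans (h.+1 * (Q.+1 - k.-1./2) + h.+1 * k.+1)).
  by rewrite leq_add2r leq_mul ?leq_sub2l //; lia.
by rewrite -mulnDr leq_mul2l; apply/orP; right; lia.
Qed.

Lemma sum_start_danger (x : tgraph) :
  \sum_v danger period h Q 0 (par (start v) : tgraph) (start v) x
    <= W * ((1 + K * W ^ K) * (2 ^ h.+1) ^ K).
Proof.
rewrite /danger exchange_big /= subn0 -/W.
rewrite -[X in _ <= X * _]card_ord -sum_nat_const; apply: leq_sum => r _.
rewrite addn0 -big_distrr /=.
apply: (@leq_trans (wt period h Q r * (1 +
    \sum_(k < K) (if k * (L.*2 + 3) <= r then W ^ k.+1 * (2 ^ h.+1) ^ k.+1 else 0)))).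
  rewrite leq_mul2l; apply/orP; right.
  apply: sum_start_nbw => //; first exact: wlen_le_top.
  exact: wlen_le_crossings.
rewrite mulnDr muln1 mulnDl mul1n leq_add //.
  have := @wt_crossings 0 r; rewrite /K mul0n addn_gt0 orbT expn1 => /(_ isT isT).
  by apply: leq_trans; rewrite leq_pmulr // expn_gt0.
rewrite big_distrr /= -mulnA -[X in _ <= X * _]card_ord -sum_nat_const.
apply: leq_sum => k _; case: ifP => kr; last by rewrite muln0.
rewrite mulnCA leq_mul //; last by apply: wt_crossings.
by rewrite leq_pexp2l // wlen_gt0.
Qed.

(** The initial position comes from averaging over the [N] starts, using [sum_start_danger] for each
    cop. *)
Theorem tree_evades (k A : nat) : 0 < A ->
  (forall j v f w, j <= K -> gwalks j v f w <= A ^ j) ->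
  (k * (W * (1 + K * (W ^ K * A ^ K)))).*2 < 2 ^ (h.-1 * Q.+1) ->
  W * ((1 + K * W ^ K) * (2 ^ h.+1) ^ K) + k < N ->
  ~ cops_win tgraph k.
Proof.
move=> A0 HA Hk HN; set Th := 2 ^ _ in Hk.
have W0 := wlen_gt0.
have kTh : k < Th.
  apply: leq_ltn_trans Hk; rewrite -addnn; apply: leq_trans (leq_addr _ _).
  by rewrite leq_pmulr // muln_gt0 W0 addn_gt0.
apply: (@escape tgraph period h Q phase _ _ _ _ k (W * (1 + K * (W ^ K * A ^ K)))) => //.
- by rewrite /period; lia.
- exact: phase_one.
- exact: phase_two.
- move=> p c x ph; apply: nbw_start_bound => //; first exact: wlen_le_top.
  exact: wlen_le_crossings.
move=> X; apply: contrapT => nost.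
(* A start fails through too much danger or through a cop on its parent; a single inequality covers
   both and can be summed over [v]. *)
have far (v : 'I_N) : Th <= \sum_j danger period h Q 0 (par (start v) : tgraph) (start v) (X j) +
    Th * \sum_j (X j == par (start v)).
  have [j0|j0] := posnP (\sum_j (X j == par (start v))); last first.
    by apply: leq_trans (leq_addl _ _); rewrite leq_pmulr.
  rewrite j0 muln0 addn0 leqNgt; apply/negP => small; apply: nost.
  exists (par (start v)), (start v); split=> //; first exact: start_phase.
  move=> j /eqP E; move/eqP: j0; rewrite sum_nat_eq0 => /forallP /(_ j).
  by rewrite /= E.
have : N * Th <= \sum_(v < N) (\sum_j danger period h Q 0 (par (start v) : tgraph) (start v) (X j) +
    Th * \sum_j (X j == par (start v))).
  rewrite -[X in X * _ <= _]card_ord -sum_nat_const; apply: leq_sum => v _; exact: far.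
rewrite big_split /= -big_distrr /= exchange_big /=.
have s1 : \sum_(j < k) \sum_(v < N) danger period h Q 0 (par (start v) : tgraph) (start v) (X j)
    <= k * (W * ((1 + K * W ^ K) * (2 ^ h.+1) ^ K)).
  rewrite -[X in _ <= X * _]card_ord -sum_nat_const; apply: leq_sum => j _.
  exact: sum_start_danger.
have s2 : \sum_(v < N) \sum_j (X j == par (start v)) <= k.
  rewrite exchange_big /= -[X in _ <= X]card_ord -sum1_card; apply: leq_sum => j _.
  apply: (@leq_trans (\sum_v (v == vtx (X j)))).
    apply: leq_sum => v _; case: eqP => // ->.
    rewrite vtx_par; last by rewrite (proj1 (startP v)) /top; lia.
    by rewrite (proj2 (startP v)) eqxx.
  by rewrite (bigD1 (vtx (X j))) //= eqxx big1 ?addn0 // => v /negPf ->.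
move=> H; have := leq_trans H (leq_add s1 (leq_mul (leqnn Th) s2)).
move: HN kTh; set E := W * _; nia.
Qed.

End Params.

End Tree.

(** * Choice of the parameters *)

Lemma exists_matching (n : nat) : ~~ odd n -> exists m : {perm 'I_n}, matching m.
Proof.
move=> even_n.
have lt_flip (i : 'I_n) : (if odd i then i.-1 else i.+1) < n.
  have := ltn_ord i; case: ifP => oi i_n; first lia.
  rewrite ltn_neqAle i_n andbT; apply: contraNneq even_n => <-.
  by rewrite /= oi.
pose flip i := Ordinal (lt_flip i).
have flipK i : flip (flip i) = i.
  apply: val_inj; rewrite /=; case: (boolP (odd i)) => oi; last by rewrite /= oi.
  by have -> : odd i.-1 = false; lia.
exists (perm (can_inj flipK)); apply/forallP => i; rewrite !permE flipK eqxx /=.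
by apply/eqP => /(congr1 val) /=; case: ifP => oi; lia.
Qed.

Lemma poly_le_exp (a e : nat) : exists h0, forall h, h0 <= h -> a * h ^ e <= 2 ^ h.
Proof.
have mono b c : b <= c -> b ^ e <= c ^ e.
  by have [->|e0] := posnP e; rewrite ?expn0 // leq_exp2r.
(* With [t = h %/ q], one factor [2 ^ t] of [2 ^ (q * t)] absorbs [a * q ^ e], the remaining [e]
   factors absorb [t.+1 ^ e]. *)
pose q := e.+1; exists (q * (a * q ^ e)) => h hh.
have t1 : a * q ^ e <= h %/ q by rewrite leq_divRL // mulnC.
have h1 : h <= q * (h %/ q).+1 by rewrite mulnC ltnW // ltn_ceil.
have h2 : q * (h %/ q) <= h by rewrite mulnC leq_trunc_div.
move: t1 h1 h2; move: (h %/ q) => t t1 h1 h2.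
apply: (@leq_trans (2 ^ (q * t))); last by rewrite leq_pexp2l.
apply: (@leq_trans (a * (q * t.+1) ^ e)); first by rewrite leq_mul2l mono ?orbT.
rewrite expnMn mulnA /q mulSn expnD leq_mul //.
  exact: leq_trans t1 (ltnW (ltn_expl t (leqnn 2))).
by rewrite mulnC expnM mono // ltn_expl.
Qed.

Theorem evasive_graphs (Q : nat) : exists h0, forall h, h0 <= h ->
  exists G : sgraph,
    [/\ graph_connected G, subcubic G, exists x : G, degree x <= 2,
      #|G| <= (2 ^ h.+1) ^ (Q.*2 + 8) &
      forall k, k <= (2 ^ h.+1) ^ Q -> ~ cops_win G k].
Proof.
(* [l] is the least number with [2 (K + 1) + K l + 1 <= (K + 1) l], the comparison of powers of [D]
   in the union bound; [A] is [K] times the size of the hitting sets. *)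
pose K := Q.*2 + 5; pose l := K.*2 + 3; pose A := K * (K * l).*2.
(* None of these depends on [h]: [c0] collects the constants of the union bound, [cW * h] bounds
   [W], and [c3 * h ^ K.+1] bounds a multiple of [cc]. *)
pose c0 := (K * l).+1 * 2 ^ (K * l) * ((K * l).+2 * 2) ^ l.
pose cW := (2 * (2 * (4 * Q.+2 + 1) + 3)) * Q.+2.
pose c3 := 4 ^ Q.+1 * 2 * ((1 + K * A ^ K) * cW ^ K.+1).
have [h0 Hh] := poly_le_exp (c0 + c3) K.+1.
exists h0.+1 => h hh.
have {Hh} := Hh h (ltnW hh).
have h_gt0 : 0 < h by lia.
pose L := 4 * h * Q.+2; pose W := wlen (period h L) Q.
pose D := 2 ^ h.+1; pose N := D ^ K.+1.
have D_gt0 : 0 < D by rewrite expn_gt0.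
have N_gt0 : 0 < N by rewrite expn_gt0 D_gt0.
have A_gt0 : 0 < A by rewrite /A /l /K; lia.
have W_gt0 : 0 < W by rewrite /W /wlen /period muln_gt0.
have W_le : W <= cW * h by rewrite /W /wlen /period /cW /L; nia.
rewrite mulnDl => Hbig.
have hp : 0 < h ^ K.+1 by rewrite expn_gt0 h_gt0.
have D2 : D = 2 * 2 ^ h by rewrite /D expnS.
have pos2 : 0 < 2 ^ h by rewrite expn_gt0.
have R1 : c0 < D.
  have : c0 <= c0 * h ^ K.+1 by rewrite leq_pmulr.
  lia.
pose cc := W * (1 + K * (W ^ K * A ^ K)).
have cc_le : cc <= (1 + K * A ^ K) * cW ^ K.+1 * h ^ K.+1.
  rewrite -mulnA -expnMn.
  apply: (@leq_trans ((1 + K * A ^ K) * W ^ K.+1)); last first.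
    by rewrite leq_mul2l leq_exp2r // W_le orbT.
  rewrite /cc expnS [X in _ <= X]mulnCA leq_mul2l mulnDl mul1n -mulnA [A ^ K * _]mulnC.
  by rewrite leq_add2r expn_gt0 W_gt0 orbT.
have R3 : 4 ^ Q.+1 * 2 * cc < D.
  have : 4 ^ Q.+1 * 2 * cc <= c3 * h ^ K.+1.
    by rewrite /c3 -[X in _ <= X]mulnA leq_mul2l cc_le orbT.
  lia.
have R3' : 8 * cc < D.
  apply: leq_ltn_trans R3; rewrite leq_mul2r expnS; apply/orP; right.
  have : 0 < 4 ^ Q by rewrite expn_gt0.
  lia.
have Wcc : W <= cc by rewrite leq_pmulr.
have [m0 Hm0] : exists m : {perm 'I_(nports h N)}, matching m.
  by apply: exists_matching; rewrite /nports expnS oddM oddM andbF.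
have Kl_le : (K * l).*2.+1 <= c0.
  rewrite /c0; apply: (@leq_trans (((K * l).+2 * 2) ^ l)).
    apply: (@leq_trans (((K * l).+2 * 2) ^ 1)); first by rewrite expn1; lia.
    by rewrite leq_pexp2l // /l addn3.
  by rewrite leq_pmull // muln_gt0 /= expn_gt0.
have D_le_N : D <= N by rewrite /N -{1}[D]expn1 leq_pexp2l.
have nE : nports h N = N * 2 ^ h + N * 2 ^ h by rewrite /nports expnS; lia.
have NH : N <= N * 2 ^ h by rewrite leq_pmulr.
have Kl_lt : (K * l).*2.+1 < nports h N by lia.
have [|||m mm Hm] := @good_matching _ _ _ _ _ (@portP h N) K l (ex_intro _ m0 Hm0).
- exact: D_gt0.
- by rewrite card_ord.
- rewrite !card_ord -/D.
  apply: (@leq_trans ((N * 2 ^ h) ^ l)); last by rewrite leq_exp2r //; lia.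
  have -> : N ^ 2 * ((K * l).+1 * (D * 2) ^ (K * l)) * ((K * l).+2 * D) ^ l =
     (N ^ 2 * D ^ (K * l) * c0) * (2 ^ h) ^ l.
    by rewrite /c0 [in (_ * D) ^ l]D2 mulnA [_.+2 * _]mulnA !expnMn; lia.
  rewrite [(N * _) ^ l]expnMn ltn_pmul2r ?expn_gt0 ?pos2 //.
  apply: (@leq_trans (N ^ 2 * D ^ (K * l) * D)).
    by rewrite ltn_pmul2l // muln_gt0 (expn_gt0 N) N_gt0 (expn_gt0 D) D_gt0.
  have -> : N ^ 2 * D ^ (K * l) * D = D ^ (K.+1 * 2 + K * l).+1.
    by rewrite [RHS]expnSr (expnD D) (expnM D K.+1 2).
  have -> : N ^ l = D ^ (K.+1 * l) by rewrite (expnM D K.+1 l).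
  by rewrite leq_pexp2l // /l; nia.
have HA j v f w : j <= K -> nbg (@vt h N) m [::] j v f w <= A ^ j.
  by move=> jK; exact: (nbg_bound Hm).
pose G := @tgraph h L W N N_gt0 m mm.
exists G; split.
- exact: tgraph_connected.
- exact: tgraph_subcubic.
- exact: low_degree.
- apply: leq_trans (card_tgraph _ _ _ _) _; rewrite -/D.
  have -> : D ^ (Q.*2 + 8) = D * (N * D).
    by rewrite /N -expnSr -expnS; congr (D ^ _); rewrite /K; lia.
  rewrite /nports -/D leq_mul //; rewrite /top.
  have : L + h.+1 <= W.
    rewrite /W /wlen; apply: (@leq_trans (period h L).*2); last by rewrite leq_pmulr.
    by rewrite /period addnS; move: (L + h) => a; lia.
  lia.
move=> k kD.
apply: (@tree_evades h L W N N_gt0 W_gt0 m mm Q h_gt0 _ _ k A A_gt0 HA) => //;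
  rewrite -/K -/W -/D.
- rewrite -/cc -(@ltn_pmul2l (4 ^ Q.+1)) ?expn_gt0 //.
  (* Since [2 ^ h.-1] is a quarter of [D], the factor [4 ^ Q.+1] turns the threshold into
     [D ^ Q.+1]. *)
  have -> : 4 ^ Q.+1 * 2 ^ (h.-1 * Q.+1) = D ^ Q * D.
    rewrite expnM -expnMn -expnSr; congr (_ ^ _).
    by rewrite D2 -[in RHS](prednK h_gt0) expnS; lia.
  apply: (@leq_ltn_trans (D ^ Q * (4 ^ Q.+1 * 2 * cc))).
    have -> : 4 ^ Q.+1 * (k * cc).*2 = k * (4 ^ Q.+1 * 2 * cc).
      by rewrite -muln2; move: (4 ^ Q.+1) (cc) => a b; lia.
    by rewrite leq_mul2r kD orbT.
  by rewrite ltn_pmul2l // expn_gt0 D_gt0.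
have le1 : W * ((1 + K * W ^ K) * D ^ K) <= cc * D ^ K.
  rewrite mulnA leq_mul2r /cc leq_mul2l leq_add2l leq_mul2l leq_pmulr ?orbT //.
  by rewrite expn_gt0 A_gt0.
have kK : k < D ^ K.
  have D1 : 1 < D by rewrite D2; lia.
  by apply: leq_ltn_trans kD _; rewrite (ltn_exp2l _ _ D1) /K; lia.
have : (cc + 1) * D ^ K <= D * D ^ K by rewrite leq_mul2r; apply/orP; right; lia.
rewrite mulnDl mul1n -expnS -/N; lia.
Qed.

(** * Padding to a prescribed order *)

Section Pendant.
Variables (G : sgraph) (z : G).

Definition pendant_adj (x y : option G) : bool :=
  match x, y with
  | Some a, Some b => adj a b
  | Some a, None | None, Some a => a == z
  | None, None => false
  end.

Lemma pendant_sym : symmetric pendant_adj.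
Proof. by move=> [a|] [b|] //=; exact: adj_sym. Qed.

Lemma pendant_irrefl : irreflexive pendant_adj.
Proof. by move=> [a|] //=; exact: adj_irrefl. Qed.

Definition pendant : sgraph := SGraph pendant_sym pendant_irrefl.

Lemma pendant_connected : graph_connected G -> graph_connected pendant.
Proof.
move=> cG.
have lift x y : connect (@adj pendant) (Some x) (Some y).
  have /connectP [p pp ->] := cG x y.
  apply/connectP; exists (map Some p); last by rewrite last_map.
  by rewrite path_map.
have cs := sym_connect_sym pendant_sym.
have toz (x : pendant) : connect (@adj pendant) x (Some z).
  by case: x => [x|]; [exact: lift | apply: connect1; rewrite /= eqxx].
by move=> x y; apply: connect_trans (toz x) _; rewrite cs; exact: toz.
Qed.

Lemma degree_pendant_None : degree (None : pendant) <= 2.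
Proof.
rewrite /degree; apply: (@leq_trans #|[set (Some z : pendant)]|); last by rewrite cards1.
apply: subset_leq_card; apply/subsetP => -[y|]; rewrite !inE //=.
Qed.

Lemma pendant_subcubic : subcubic G -> degree z <= 2 -> subcubic pendant.
Proof.
move=> sG dz [x|]; last exact: leq_trans degree_pendant_None _.
rewrite /degree.
have sub : [set y : pendant | adj (Some x : pendant) y] \subset
    (if x == z then [set None] else set0) :|: (Some @: [set y | adj x y]).
  apply/subsetP => -[y|]; rewrite !inE /=.
    by move=> a; apply/orP; right; apply/imsetP; exists y; rewrite ?inE.
  by move=> ->; rewrite inE eqxx.
apply: leq_trans (subset_leq_card sub) _; apply: leq_trans (leq_card_setU _ _) _.
have im : #|(Some @: [set y | adj x y] : {set pendant})| <= degree x by exact: leq_imset_card.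
case: eqP => [xz|_]; rewrite ?cards1 ?cards0.
  by rewrite add1n ltnS; apply: leq_trans im _; rewrite xz.
by rewrite add0n; apply: leq_trans im (sG x).
Qed.

(** Retracting the new vertex onto [z] keeps the cops' moves legal, and against a robber who stays
    in [G] it preserves captures. *)
Lemma cops_win_pendant k : cops_win pendant k -> cops_win G k.
Proof.
move=> [s Hs]; pose retr (x : pendant) : G := if x is Some a then a else z.
have retr_legal x y : legal_move x y -> legal_move (retr x) (retr y).
  rewrite /legal_move; move=> /orP[/eqP->|]; first by rewrite eqxx.
  by case: x => [a|]; case: y => [b|] //=; [move=> ->; rewrite orbT | move=> -> | rewrite eq_sym => ->].
exists (fun l => [ffun j => retr (s (map Some l) j)]) => r rw.
have [|leg [i [j cap]]] := Hs (fun n => Some (r n)).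
  move=> i; have := rw i; rewrite /legal_move => /orP[/eqP->|a]; first by rewrite eqxx.
  by apply/orP; right.
have E i' j' : cops_at (fun l => [ffun j => retr (s (map Some l) j)]) r i' j' =
    retr (cops_at s (fun n => Some (r n)) i' j').
  by rewrite /cops_at ffunE /mkseq -map_comp.
split; first by move=> i' j'; rewrite !E; apply: retr_legal; exact: leg.
by exists i, j; case: cap => H; [left | right]; rewrite E H.
Qed.

End Pendant.

(** Each added vertex has degree at most 2 and serves as the next point of attachment. *)
Lemma pad_graph (G : sgraph) (p : nat) :
  graph_connected G -> subcubic G -> (exists x : G, degree x <= 2) ->
  exists G' : sgraph, [/\ graph_connected G', subcubic G', #|G'| = #|G| + p &
    forall k, cops_win G' k -> cops_win G k].
Proof.
elim: p G => [|p IH] G cG sG [z dz]; first by exists G; rewrite addn0.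
have [||| G' [H1 H2 H3 H4]] := IH (pendant z).
- exact: pendant_connected.
- exact: pendant_subcubic.
- by exists None; exact: degree_pendant_None.
exists G'; split=> //; first by rewrite H3 card_option addnS.
by move=> k /H4; exact: cops_win_pendant.
Qed.

(** * The lower bound for every order *)

Lemma lt_cop_number (G : sgraph) (b : nat) :
  (forall k, k <= b -> ~ cops_win G k) -> b < cop_number G.
Proof.
move=> H; rewrite /cop_number; case: ex_minnP => k /asboolP wk _.
by rewrite ltnNge; apply/negP => /H; apply.
Qed.

Import Order.TTheory GRing.Theory Num.Theory.
Local Open Scope ring_scope.

Theorem theorem3p2 (R : realType) (eps : R) (heps : 0 < eps) :
  exists (C : R) (n0 : nat), 0 < C /\
    forall n : nat, (n0 <= n)%N ->
      exists G : sgraph,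
        [/\ #|G| = n, graph_connected G, subcubic G
          & C * n%:R `^ (1 / 2 - eps) <= (cop_number G)%:R].
Proof.
(* The order lies between [D ^ B] and [D ^ B.+1] with [B + 1 = 2 Q + 9], and [Q > 5 / eps] makes
   [Q / (2 Q + 9)] at least [1 / 2 - eps]. *)
pose Q := (Num.bound (5 / eps)).+1.
have [h0 Hh] := evasive_graphs Q.
(* [H0] is at least [B] so that [B <= h], which compensates for rounding down [e / B] in the bound
   of [n] by [D ^ B.+1]. *)
pose B := (Q.*2 + 8)%N; pose H0 := maxn h0 B.
exists 1, (2 ^ (H0.+2 * B))%N; split=> // n n_large.
have B_gt0 : (0 < B)%N by rewrite /B addn_gt0 orbT.
have n_gt0 : (0 < n)%N by apply: leq_trans n_large; rewrite expn_gt0.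
pose e := trunc_log 2 n.
have /andP[le_n n_lt] : (2 ^ e <= n < 2 ^ e.+1)%N by exact: trunc_log_bounds.
have e_large : (H0.+2 * B <= e)%N.
  by rewrite -ltnS -(@ltn_exp2l 2) // (leq_ltn_trans n_large).
pose h := (e %/ B).-1.
have eB : (H0.+2 <= e %/ B)%N by rewrite leq_divRL.
have hE : (h.+1 = e %/ B)%N by rewrite /h prednK //; lia.
have hH0 : (H0 <= h)%N by lia.
have [|G [cG sG dG card_G evade]] := Hh h; first by rewrite /H0 in hH0; lia.
pose D := (2 ^ h.+1)%N.
have DB_le : (D ^ B <= n)%N.
  apply: leq_trans le_n; rewrite -expnM leq_pexp2l // hE; exact: leq_trunc_div.
have n_le : (n <= D ^ B.+1)%N.
  apply: leq_trans (ltnW n_lt) _; rewrite -expnM leq_pexp2l //.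
  have : (e < (e %/ B).+1 * B)%N by exact: ltn_ceil.
  by rewrite -hE mulSn mulnS; have : (B <= h)%N; [rewrite /H0 in hH0; lia | lia].
have [G' [cG' sG' card_G' win]] := pad_graph (n - #|G|) cG sG dG.
exists G'; split=> //; first by rewrite card_G' subnKC // (leq_trans card_G).
have cop_large : (D ^ Q < cop_number G')%N.
  by apply: lt_cop_number => k kQ /win; exact: evade.
rewrite mul1r; apply: (@le_trans _ _ (D ^ Q)%:R); last by rewrite ler_nat ltnW.
pose q : R := Q%:R / B.+1%:R.
have q_ge0 : 0 <= q by rewrite divr_ge0 ?ler0n.
have q_large : 1 / 2 - eps <= q.
  have bnd : 5 / eps < Q%:R.
    apply: lt_trans (archi_boundP _) _; first by rewrite divr_ge0 // ltW.
    by rewrite ltr_nat.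
  have Q5 : 5 < eps * Q%:R by rewrite mulrC -ltr_pdivrMr.
  rewrite /q ler_pdivlMr ?ltr0n //.
  have -> : B.+1%:R = 2 * Q%:R + 9 :> R.
    by rewrite /B -addn1 -addnA natrD -muln2 natrM mulrC.
  have Q0 : 0 <= Q%:R :> R by rewrite ler0n.
  nra.
apply: (@le_trans _ _ (n%:R `^ q)); first by rewrite ler_powR // ler1n.
apply: (@le_trans _ _ ((D ^ B.+1)%:R `^ q)).
  by apply: ge0_ler_powR; rewrite ?nnegrE ?ler0n // ler_nat.
rewrite natrX -powR_mulrn ?ler0n // -powRrM.
have -> : B.+1%:R * q = Q%:R by rewrite /q mulrC divfK // pnatr_eq0.
by rewrite powR_mulrn ?ler0n // natrX.
Qed.
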